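(* Let $\langle X,\tau\rangle$ be a $T_3$ space and let $\mu$ be a cardinal such that every point $p\in X$ has an open neighbourhood $G\in\tau$ with $|G|\le\mu$. If there is no strongly inaccessible cardinal less than or equal to $\mu$, then $X$ has a Noetherian base.
   Context: A base $\mathcal B$ of a topological space is a Noetherian base if it contains no infinite strictly $\subseteq$-increasing sequence. A cardinal is strongly inaccessible if it is uncountable, regular and a strong limit. *)

(* Defs.v *)
From HB Require Import structures.
From mathcomp Require Import all_boot all_order all_algebra.
From mathcomp Require Import all_classical all_reals all_analysis.
Set Implicit Arguments. Unset Strict Implicit. Unset Printing Implicit Defensive.
Local Open Scope classical_set_scope.
Local Open Scope card_scope.

(* Cardinals are handled relationally, via mathcomp's [A #<= B]. *)
Definition card_lt T U (A : set T) (B : set U) := A #<= B /\ ~ (B #<= A).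

Definition uncountable_card T (K : set T) := ~ countable K.

Definition regular_card T (K : set T) :=
  forall (I : Type) (J : set I) (F : I -> set T),
    card_lt J K -> (forall i, J i -> card_lt (F i) K) ->
    ~ (K `<=` \bigcup_(i in J) F i).

Definition strong_limit_card T (K : set T) :=
  forall (I : Type) (L : set I),
    card_lt L K -> card_lt [set A : set I | A `<=` L] K.

Definition strongly_inaccessible T (K : set T) :=
  [/\ uncountable_card K, regular_card K & strong_limit_card K].

Definition T3_space (X : topologicalType) :=
  accessible_space X /\ regular_space X.

Definition is_base (X : topologicalType) (B : set (set X)) :=
  (forall A, B A -> open A) /\
  (forall U : set X, open U ->
     U = \bigcup_(A in [set A | B A /\ A `<=` U]) A).

Definition noetherian_family T (B : set (set T)) :=
  ~ exists f : nat -> set T, (forall n, B (f n)) /\ (forall n, f n `<` f n.+1).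

Definition has_noetherian_base (X : topologicalType) :=
  exists B : set (set X), is_base B /\ noetherian_family B.

(* Main.v *)
(* Given Noetherian families indexed by labels, a Noetherian union is obtained by
   deleting from each member [U] of the family number [l] the closure of an open
   set [R l], where the sets [R l] are pairwise incomparable and placed where a
   well-ordering finds them again: along an increasing sequence of such sets the
   label is eventually constant. This is possible when small open sets contain as
   many incomparable open sets as there are labels.
   Fix a maximal disjoint family of open cells which are singletons or contain,
   in each nonempty open subset, an incomparable family as large as the set of
   regular open traces on the cell. The support of an open set is the set of cells
   that it meets. Regular open sets with a given support are separated by labels
   stored in the cells. A support of size at most [K] gets as label a subset of [K],
   such that comparable supports with the same label are equal; an open set that
   meets [K] cells has room for these [2^K] labels. Finally the minimal sizes [K]
   of the supports of neighbourhoods are treated by induction: the sizes below a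
   singular [K] are separated by [cf K] labels, and the sizes below a [K] which is
   not a strong limit by [2^L >= K] labels for some [L < K]. *)
Require Import Defs.
From HB Require Import structures.
From mathcomp Require Import all_boot all_order all_algebra.
From mathcomp Require Import all_classical all_reals all_analysis.
Set Implicit Arguments. Unset Strict Implicit. Unset Printing Implicit Defensive.
Local Open Scope classical_set_scope.
Local Open Scope card_scope.

(** * Well-orders and recursion along them *)

Definition wo T (lt : T -> T -> Prop) :=
  [/\ well_founded lt, (forall x y z, lt x y -> lt y z -> lt x z) &
      forall x y, [\/ lt x y, x = y | lt y x]].

Lemma wo_irr T (lt : T -> T -> Prop) : wo lt -> forall x, ~ lt x x.
Proof.
by move=> [wf _ _] x; elim/(well_founded_ind wf): x => x IH xx; exact: (IH x).
Qed.

(** Unique least elements of two-element sets make the relation of the well-ordering principle total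
    and antisymmetric, those of three-element sets make it transitive; its strict part is then well
    founded. *)
Lemma exists_wo (T : Type) : exists lt : T -> T -> Prop, wo lt.
Proof.
elim/Peq : T => T.
have [R Rwo] := wochoice.well_ordering_principle T.
have min (A : set T) : A !=set0 -> exists2 z, A z & forall x, A x -> R z x.
  move=> [a Aa]; have [|z [[zA zm] _]] := Rwo (fun x => `[< A x >]).
    by exists a; apply/asboolP.
  by exists z; [exact/asboolP|move=> x Ax; apply: zm; exact/asboolP].
have Rtot x y : R x y \/ R y x.
  have [|z [->|->] H] := min [set x; y]; first by exists x; left.
    by left; apply: H; right.
  by right; apply: H; left.
have Ranti x y : R x y -> R y x -> x = y.
  move=> xy yx; have [|z [_ zu]] := Rwo (fun u => `[< u = x \/ u = y >]).
    by exists x; apply/asboolP; left.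
  have xx : R x x by case: (Rtot x x).
  have yy : R y y by case: (Rtot y y).
  rewrite -(zu x); last first.
    by split; [apply/asboolP; left|move=> u /asboolP[->|->]].
  by apply: zu; split; [apply/asboolP; right|move=> u /asboolP[->|->]].
exists (fun x y => R x y /\ x <> y); split.
- move=> x; apply: contrapT => nx.
  have [|z nz zm] := min [set x | ~ Acc (fun x y => R x y /\ x <> y) x].
    by exists x.
  apply: nz; constructor => y [yz yNz]; apply: contrapT => ny.
  exact: yNz (Ranti _ _ yz (zm _ ny)).
- move=> x y z [xy nxy] [yz nyz].
  have [|m] := min [set x; y; z]; first by exists x; left; left.
  have [xz|zx] := Rtot x z.
    by split=> // exz; subst z; exact: nxy (Ranti _ _ xy yz).
  move=> [[->|->]|->] H; exfalso.
  - have e := Ranti _ _ zx (H z (or_intror erefl)).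
    by subst z; exact: nxy (Ranti _ _ xy yz).
  - by exact: nxy (Ranti _ _ xy (H x (or_introl (or_introl erefl)))).
  - by exact: nyz (Ranti _ _ yz (H y (or_introl (or_intror erefl)))).
- move=> x y; have [->|nxy] := pselect (x = y); first by constructor 2.
  have [xy|yx] := Rtot x y; first by constructor 1.
  by constructor 3; split=> // e; apply: nxy.
Qed.

Lemma wf_min T (lt : T -> T -> Prop) (A : set T) : well_founded lt ->
  A !=set0 -> exists2 x, A x & forall y, A y -> ~ lt y x.
Proof.
move=> wf [a]; elim/(well_founded_ind wf): a => a IH Aa.
have [[b Ab ba]|nb] := pselect (exists2 b, A b & lt b a); first exact: IH ba Ab.
by exists a => // y Ay ya; apply: nb; exists y.
Qed.

(** The value at [x] is only constrained by [Q], not computed. Since [Q] sees [g] only below [x],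
    the default [u0] can fill [g] elsewhere. *)
Lemma wf_rec T U (lt : T -> T -> Prop) (Q : T -> (T -> U) -> U -> Prop) (u0 : U) :
  well_founded lt ->
  (forall x g g' u, (forall y, lt y x -> g y = g' y) -> Q x g u -> Q x g' u) ->
  (forall x g, exists u, Q x g u) ->
  exists f : T -> U, forall x, Q x f (f x).
Proof.
move=> wf Qloc Qex.
pose F x (r : forall y, lt y x -> U) : U :=
  sval (cid (Qex x (fun y => if pselect (lt y x) is left h then r y h else u0))).
exists (Fix wf (fun=> U) F) => x.
rewrite Fix_eq; last first.
  move=> y g g' gg'; rewrite (_ : g = g') //.
  by apply: functional_extensionality_dep => z; apply: functional_extensionality_dep.
rewrite /F; case: cid => u /= Hu; apply: Qloc Hu => y yx.
by case: pselect.
Qed.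

(** * Cardinals *)

Lemma card_le_fun T U (A : set T) (B : set U) (f : T -> U) :
  set_fun A B f -> set_inj A f -> A #<= B.
Proof.
move=> fAB fi; have [g] : $|{injfun A >-> B}| by apply/injfunPex; exists f.
exact: inj_card_le g.
Qed.

Lemma card_le_ex T U (A : set T) (B : set U) (u0 : U) : A #<= B ->
  exists2 f : T -> U, set_fun A B f & set_inj A f.
Proof.
move=> /card_leP[f].
exists (fun x => if pselect (A x) is left h then val (f (SigSub (mem_set h))) else u0).
  move=> x Ax; case: pselect => // h; exact: set_mem (valP (f _)).
move=> x y /set_mem Ax /set_mem Ay; case: pselect => // hx; case: pselect => // hy.
move=> /val_inj /(inj (mem_setT _) (mem_setT _)) e.
by have := congr1 val e.
Qed.

Lemma card_leT_ex T U : [set: T] #<= [set: U] -> exists f : T -> U, injective f.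
Proof.
move=> /card_leP[f].
exists (fun x => val (f (SigSub (mem_set I : x \in [set: T])))).
move=> x y /val_inj /(inj (mem_setT _) (mem_setT _)) e.
by have := congr1 val e.
Qed.

Lemma card_le_neq0 T U (A : set T) (B : set U) : A #<= B -> A !=set0 -> B !=set0.
Proof.
by move=> /card_leP[f] [x Ax]; exists (val (f (SigSub (mem_set Ax)))); exact: set_mem (valP (f _)).
Qed.

Lemma greedy T U (lt : T -> T -> Prop) (P : set T) (C : set U) : well_founded lt ->
  (forall x y, [\/ lt x y, x = y | lt y x]) ->
  (forall x, P x -> ~ (C #<= [set y | P y /\ lt y x])) -> P #<= C.
Proof.
move=> wf tot H.
have [[x0 Px0]|P0] := pselect (P !=set0); last first.
  by rewrite (_ : P = set0) ?card_ge0 //; apply/seteqP; split => // x Px; apply: P0; exists x.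
have [u0 Cu0] : C !=set0.
  apply: contrapT => C0; apply: (H _ Px0).
  by rewrite (_ : C = set0) ?card_ge0 //; apply/seteqP; split => // x Px; apply: C0; exists x.
have [||f fP] := @wf_rec T U lt (fun x g u => P x -> C u /\ ~ (g @` [set y | P y /\ lt y x]) u) u0 wf.
- move=> x g g' u gg' Q Px; have [Cu nu] := Q Px; split=> // -[y [Py yx] yu].
  by apply: nu; exists y => //; rewrite gg'.
- move=> x g; have [Px|nPx] := pselect (P x); last by exists u0.
  apply: contrapT => nu; apply: (H _ Px).
  apply: card_le_trans (card_image_le g _).
  apply: subset_card_le => u Cu; apply: contrapT => nu'; apply: nu.
  by exists u.
- apply: (@card_le_fun _ _ _ _ f) => [x Px|x y /set_mem Px /set_mem Py fxy].
    by have [] := fP x Px.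
  case: (tot x y) => // xy; exfalso.
    by have [_] := fP y Py; apply; exists x.
  by have [_] := fP x Px; apply; exists y.
Qed.

(** Cut [P] at the first point whose initial segment is at least as large as [C]; by [greedy] that
    segment is no larger. Cardinals are compared in this way throughout. *)
Lemma card_segP T U (lt : T -> T -> Prop) (P : set T) (C : set U) : wo lt ->
  P #<= C \/ exists x, P x /\ C #= [set y | P y /\ lt y x].
Proof.
move=> w; have [wf tr tot] := w.
have [[x [Px Cx]]|nx] := pselect (exists x, P x /\ C #<= [set y | P y /\ lt y x]); last first.
  by left; apply: (greedy wf tot) => x Px Cx; apply: nx; exists x.
right.
have [z [Pz Cz] zm] := wf_min (A := [set x | P x /\ C #<= [set y | P y /\ lt y x]]) wf (ex_intro _ x (conj Px Cx)).
exists z; split => //.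
rewrite card_eq_le Cz /=; apply: (greedy wf tot) => y [Py yz] Cy.
apply: (zm y _ yz); split=> //; apply: card_le_trans Cy _.
by apply: subset_card_le => t [[Pt _] ty].
Qed.

Lemma card_le_total T U (A : set T) (B : set U) : A #<= B \/ B #<= A.
Proof.
have [lt w] := exists_wo T; have [|[x [_ Bx]]] := card_segP A B w; first by left.
right; move: Bx; rewrite card_eq_le => /andP[Bx _]; apply: card_le_trans Bx _.
by apply: subset_card_le => y [].
Qed.

Lemma card_ltP T U (A : set T) (B : set U) : card_lt A B <-> ~ (B #<= A).
Proof. by split=> [[]//|nBA]; split=> //; have [] := card_le_total A B. Qed.

(** Members of [Q] smaller than a fixed [A0] become initial segments of [A0], and the first of these
    is taken. *)
Lemma card_min T (Q : set (set T)) : Q !=set0 ->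
  exists2 A, Q A & forall B, Q B -> A #<= B.
Proof.
move=> [A0 QA0]; have [lt w] := exists_wo T; have [wf tr tot] := w.
have [[x [Ax [B [QB Bx]]]]|nx] := pselect (exists x, A0 x /\ exists B, Q B /\ B #= [set y | A0 y /\ lt y x]); last first.
  exists A0 => // B QB; have [//|[x [A0x Bx]]] := card_segP A0 B w.
  by exfalso; apply: nx; exists x; split => //; exists B.
have [z [Az [C [QC Cz]]] zm] := wf_min (A := [set x | A0 x /\ exists B, Q B /\ B #= [set y | A0 y /\ lt y x]]) wf (ex_intro _ x (conj Ax (ex_intro _ B (conj QB Bx)))).
exists C => // D QD.
move: Cz; rewrite card_eq_le => /andP[Cz _]; apply: card_le_trans Cz _.
have [A0D|[y [A0y Dy]]] := card_segP A0 D w.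
  by apply: card_le_trans A0D; apply: subset_card_le => t [].
have nyz : ~ lt y z by apply: zm; split=> //; exists D.
move: Dy; rewrite card_eq_le => /andP[_]; apply: card_le_trans.
apply: subset_card_le => t [At tz]; split=> //.
case: (tot z y) => [zy|<-//|//]; exact: tr zy.
Qed.

Lemma card_ind T (P : set T -> Prop) :
  (forall K, (forall K', card_lt K' K -> P K') -> P K) -> forall K, P K.
Proof.
move=> H K; apply: contrapT => nK.
have [A nA Am] := @card_min T [set A | ~ P A] (ex_intro _ K nK).
apply: nA; apply: H => K' [_ nAK']; apply: contrapT => nK'; apply: nAK'.
exact: Am.
Qed.

(** Hilbert's hotel: shifting along a sequence in [S] frees [h 0], which then takes the place of
    [m]. *)
Lemma infinite_card_leD1 T (S : set T) m : infinite_set S -> S #<= S `\ m.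
Proof.
move=> infS; have [s0 Ss0] := infinite_setN0 infS.
have [h hS hi] := card_le_ex s0 ((infiniteP S).1 infS).
have {}hi : injective h by move=> x y; apply: hi; exact: mem_setT.
pose f x := if pselect (exists n, h n = x) is left e then h (sval (cid e)).+1 else x.
apply: (@card_le_trans _ _ _ (S `\ h 0%N)).
  apply: (card_le_fun (f := f)) => [x Sx|x y _ _]; rewrite /f.
    case: pselect => [e|ne]; last by split=> // e; apply: ne; exists 0%N.
    by case: cid => n /= _; split; [exact: hS|move=> /hi].
  case: pselect => [e|ne]; case: pselect => [e'|ne'] //.
  - by case: cid => n /= en; case: cid => n' /= en' /hi[nn]; rewrite -en -en' nn.
  - by move=> ey; exfalso; apply: ne'; rewrite -ey; case: cid => n _ /=; exists n.+1.
  - by move=> ey; exfalso; apply: ne; rewrite ey; case: cid => n _ /=; exists n.+1.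
apply: (card_le_fun (f := fun x => if pselect (x = m) then h 0%N else x)).
  move=> x [Sx nx]; case: pselect => [e|//]; split; first exact: hS.
  by rewrite /= -e => e0; apply: nx; rewrite e0.
move=> x y /set_mem[_ nx] /set_mem[_ ny].
by case: (pselect (x = m)) => [ex|nxm]; case: (pselect (y = m)) => [ey|nym] /= e; rewrite ?ex ?ey //; exfalso; solve [exact: ny|exact: nx].
Qed.

Lemma card_leX T T' U U' (A : set T) (A' : set T') (B : set U) (B' : set U') :
  A #<= A' -> B #<= B' -> A `*` B #<= A' `*` B'.
Proof.
move=> AA BB; have [[[a b] [/= Aa Bb]]|n0] := pselect ((A `*` B) !=set0); last first.
  rewrite (_ : A `*` B = set0) ?card_ge0 //.
  by apply/seteqP; split => // x Px; apply: n0; exists x.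
have [a' _] := card_le_neq0 AA (ex_intro _ a Aa).
have [b' _] := card_le_neq0 BB (ex_intro _ b Bb).
have [f fA fi] := card_le_ex a' AA; have [g gB gi] := card_le_ex b' BB.
apply: (card_le_fun (f := fun x : T * U => (f x.1, g x.2))) => [x [/= Ax Bx]|].
  by split=> /=; [apply: fA|apply: gB].
move=> [x1 x2] [y1 y2] /set_mem /= [/= Ax Bx] /set_mem /= [/= Ay By] /= [ef eg].
by rewrite (fi _ _ (mem_set Ax) (mem_set Ay) ef) (gi _ _ (mem_set Bx) (mem_set By) eg).
Qed.

(** Cutting [K] at the first point, if any, whose segment is as large as [K] leaves a set ordered
    like an initial ordinal. *)
Lemma card_initial T (lt : T -> T -> Prop) (K : set T) : wo lt ->
  exists K1, [/\ K1 `<=` K, K #<= K1 &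
    forall y, K1 y -> ~ (K1 #<= [set z | K1 z /\ lt z y])].
Proof.
move=> w; have [wf tr tot] := w.
have [[x [Kx hx]]|nx] := pselect (exists x, K x /\ K #<= [set z | K z /\ lt z x]); last first.
  exists K; split => // y Ky h; apply: nx; by exists y.
have [z [Kz hz] zm] := wf_min (A := [set x | K x /\ K #<= [set z | K z /\ lt z x]]) wf (ex_intro _ x (conj Kx hx)).
exists [set y | K y /\ lt y z]; split=> // [y []//|y [Ky yz] h].
apply: (zm y _ yz); split=> //; apply: card_le_trans hz _; apply: card_le_trans h _.
by apply: subset_card_le => t [[]].
Qed.

(** Order pairs by maximum, then lexicographically. The predecessors of a pair lie in the square of
    a smaller set, which is small by induction, so [greedy] applies. *)
Lemma card_le_sq T (K : set T) : infinite_set K -> K `*` K #<= K.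
Proof.
have [lt w] := exists_wo T; have [wf tr tot] := w.
elim/card_ind: K => K IH infK.
have [K1 [K1K KK1 K1i]] := card_initial K w.
suff H : K1 `*` K1 #<= K1.
  apply: card_le_trans (card_leX KK1 KK1) _; apply: card_le_trans H _.
  exact: subset_card_le.
have infK1 : infinite_set K1 by move=> f; apply: infK; apply: card_le_finite f.
pose mx a b := if pselect (lt a b) then b else a.
pose lt2 (p q : T * T) := lt (mx p.1 p.2) (mx q.1 q.2) \/
  mx p.1 p.2 = mx q.1 q.2 /\ (lt p.1 q.1 \/ p.1 = q.1 /\ lt p.2 q.2).
have wf2 : well_founded lt2.
  suff H m : forall a b c, mx b c = m -> b = a -> Acc lt2 (b, c) by move=> [b c]; exact: H.
  elim/(well_founded_ind wf): m => m IHm; elim/(well_founded_ind wf) => a IHa b.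
  elim/(well_founded_ind wf) => c IHc em eb; constructor => -[b' c'] [/=|/=].
    by rewrite em => h; exact: (IHm _ h b').
  move=> [em' [h|[eb' h]]]; first by apply: (IHa b') => //; [rewrite -eb|rewrite em'].
  by rewrite /= in em'; rewrite eb' in em' *; apply: IHc => //; rewrite em'.
have tot2 p q : [\/ lt2 p q, p = q | lt2 q p].
  case: p q => [a b] [c d]; have [h|e|h] := tot (mx a b) (mx c d).
  - by constructor 1; left.
  - have [h|e1|h] := tot a c; first by constructor 1; right; split=> //; left.
    + have [h|e2|h] := tot b d.
      * by constructor 1; right; split=> //; right.
      * by constructor 2; rewrite e1 e2.
      * by constructor 3; right; split=> //; right.
    + by constructor 3; right; split=> //; left.
  - by constructor 3; left.
apply: (greedy wf2 tot2) => -[a b] [/= K1a K1b] h.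
pose m := mx a b; have K1m : K1 m by rewrite /m /mx; case: pselect.
(* [S] contains [m] itself; [infinite_card_leD1] removes it, so that [S] can be compared with the
   segment below [m]. *)
pose S := [set z | K1 z /\ (lt z m \/ z = m)].
have Slt : card_lt S K1.
  apply/card_ltP => K1S; apply: (K1i _ K1m); apply: (card_le_trans K1S).
  have infS : infinite_set S.
    by move=> f; apply: infK1; apply: card_le_finite f; exact: K1S.
  apply: card_le_trans (infinite_card_leD1 m infS) _.
  by apply: subset_card_le => z [[K1z [lz|ez]] nz] //; case: (nz ez).
have K1SS : K1 #<= S `*` S.
  apply: card_le_trans h _; apply: subset_card_le => -[c d] [[/= K1c K1d] h].
  have lem : lt (mx c d) m \/ mx c d = m by case: h => [|[]]; [left|right].
  have le1 : lt c (mx c d) \/ c = mx c d by rewrite /mx; case: pselect => /=; [left|right].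
  have le2 : lt d (mx c d) \/ d = mx c d.
    rewrite /mx; case: pselect => /= [|n]; first by right.
    by have [//|->|] := tot c d; [right|left].
  split; split=> //=.
    by case: lem => [l|<-//]; case: le1 => [l1|->]; left=> //; exact: tr l1 l.
  by case: lem => [l|<-//]; case: le2 => [l1|->]; left=> //; exact: tr l1 l.
have [finS|infS] := pselect (finite_set S).
  by apply: infK1; apply: card_le_finite K1SS (finite_setX finS finS).
have [_ n] := Slt; apply: (n); apply: card_le_trans K1SS _; apply: IH => //.
split; first by apply: subset_card_le => z [/K1K].
by move=> KS; apply: n; apply: (card_le_trans _ KS); exact: subset_card_le.
Qed.

Lemma exists_pairing K : infinite_set [set: K] ->
  exists f : K * K -> K, injective f.
Proof.
move=> /card_le_sq; rewrite setXTT; exact: card_leT_ex.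
Qed.

Lemma exists_chooser T (t0 : T) : exists sel : set T -> T, forall P, P !=set0 -> P (sel P).
Proof.
exists (fun P => if pselect (P !=set0) is left h then sval (cid h) else t0).
by move=> P P0; case: pselect => // h; case: cid.
Qed.

(** * Order types and the colouring of sets *)

Section OrderType.
Variables (I K : Type) (lt : I -> I -> Prop).
Hypothesis ltwo : wo lt.
Local Notation le x y := (x = y \/ lt x y).

(** A copy on [K] of the order of [J]. It is reflexive so that the range of [e] can be read off from
    [r]. *)
Definition transported (J : set I) (r : K -> K -> Prop) :=
  exists e : I -> K, set_inj J e /\
    r = fun a b => exists x y, [/\ J x, J y, a = e x, b = e y & le x y].

Lemma transported_ex (J : set I) (k0 : K) : J #<= [set: K] -> exists r, transported J r.
Proof. by move=> /(card_le_ex k0)[e _ ei]; eexists; exists e; split; first exact: ei. Qed.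

(** A common copy [r] gives an order embedding of [J'] into its subset [J], and such an embedding
    moves no point down. So every [y] is dominated by its image. *)
Lemma transported_cofinal (J J' : set I) r : transported J r -> transported J' r ->
  J `<=` J' -> forall y, J' y -> exists2 x, J x & le y x.
Proof.
have [wf tr tot] := ltwo.
move=> [e [ei er]] [e' [ei' er']] JJ'.
have iff x y x' y' : J x -> J y -> J' x' -> J' y' -> e x = e' x' -> e y = e' y' ->
    le x' y' -> le x y.
  move=> Jx Jy Jx' Jy' ex ey lxy.
  have : r (e x) (e y) by rewrite er' ex ey; exists x', y'.
  rewrite er => -[x1 [y1 [Jx1 Jy1 ex1 ey1]]].
  have <- := ei _ _ (mem_set Jx) (mem_set Jx1) ex1.
  by have <- := ei _ _ (mem_set Jy) (mem_set Jy1) ey1.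
have dom x' : J' x' -> exists2 x, J x & e x = e' x'.
  move=> Jx'; have : r (e' x') (e' x') by rewrite er'; exists x', x'; split=> //; left.
  by rewrite er => -[x [_ [Jx _ -> _ _]]]; exists x.
have key x' : forall x, J' x' -> J x -> e x = e' x' -> ~ lt x x'.
  elim/(well_founded_ind wf): x' => x' IH x Jx' Jx ex xx'.
  have [z Jz ez] := dom x (JJ' _ Jx).
  have zx : le z x by apply: (iff z x x x') => //; [exact: JJ'|right].
  case: zx => [zx|zx]; last exact: (IH x xx' z (JJ' _ Jx) Jz ez zx).
  move: xx'; suff -> : x = x' by exact: (wo_irr ltwo).
  by apply: ei'; [exact/mem_set/JJ'|exact: mem_set|rewrite -ez -ex zx].
move=> y Jy; have [x Jx ex] := dom y Jy; exists x => //.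
by have [xy|->|yx] := tot x y; [case: (key _ _ Jy Jx ex xy)|left|right].
Qed.
End OrderType.

(* The colour of [J] records its order type and the colours of the pieces into
   which [J] is cut by a short cofinal sequence that depends only on the downward
   closure of [J]. If [J `<=` J'] have the same order type, then [J] is cofinal
   in [J'], so both are cut at the same places. *)
Lemma antichain_colouring (I K : Type) : infinite_set [set: K] ->
  exists col : set I -> set K, forall J J', J `<=` J' -> J' #<= [set: K] ->
    col J = col J' -> J = J'.
Proof.
move=> infK; have [lt w] := exists_wo I; have [wf tr tot] := w.
have [pr pri] := exists_pairing infK.
have [h _ /(_ _ _ (mem_setT _) (mem_setT _)) hi] : exists2 h : nat -> K, set_fun [set: nat] [set: K] h & set_inj [set: nat] h.
  by have [k0 _] := infinite_setN0 infK; apply: (card_le_ex k0); exact/infiniteP.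
pose k0 := h 0%N; pose k1 := h 1%N.
have k01 : k0 <> k1 by move=> /hi.
(* Two relations on [K] are packed into one subset of [K], told apart by the tags [k0] and [k1]. *)
pose enc (r g : K -> K -> Prop) : set K := fun k =>
  (exists a b, r a b /\ k = pr (k0, pr (a, b))) \/ (exists a b, g a b /\ k = pr (k1, pr (a, b))).
have enci r g r' g' : enc r g = enc r' g' -> r = r' /\ g = g'.
  have sub s t s' t' : enc s t = enc s' t' ->
      (forall a b, s a b -> s' a b) /\ (forall a b, t a b -> t' a b).
    move=> E; split=> a b sab.
      have : enc s t (pr (k0, pr (a, b))) by left; exists a, b.
      rewrite E => -[] [a' [b' [H /pri[]]]]; last by move=> /k01.
      by move=> /pri[-> ->].
    have : enc s t (pr (k1, pr (a, b))) by right; exists a, b.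
    rewrite E => -[] [a' [b' [H /pri[]]]]; first by move=> /esym/k01.
    by move=> /pri[-> ->].
  move=> E; have [H1 H2] := sub _ _ _ _ E; have [H3 H4] := sub _ _ _ _ (esym E).
  by split; apply/funext => a; apply/funext => b; apply/propext; split; auto.
have [sel selP] := exists_chooser (fun _ _ : K => False).
pose tag J := sel (transported lt J).
have [i0|noI] := pselect (exists i : I, True); last first.
  exists (fun=> set0) => J J' _ _ _; apply/seteqP; split => x; exfalso; apply: noI; by exists x.
case: i0 => i0 _.
have [sel2 selP2] := exists_chooser (fun _ : K => i0).
pose down (J : set I) := [set x | exists2 y, J y & x = y \/ lt x y].
pose below (J : set I) l := [set x | J x /\ lt x l].
(* [en D] is a cofinal [K]-sequence in [D] whenever there is one. *)
pose cof (D : set I) := [set en : K -> I | (forall k, D (en k)) /\ forall x, D x -> exists k, x = en k \/ lt x (en k)].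
pose en D := sel2 (cof D).
pose prec (J J' : set I) := exists2 l, down J' l & forall x, down J x -> lt x l.
have precwf : well_founded prec.
  have H l : forall J, (forall x, down J x -> lt x l) -> Acc prec J.
    elim/(well_founded_ind wf): l => l IH J Jl; constructor => J' [l' Jl' H].
    by apply: (IH l') => //; exact: Jl.
  by move=> J; constructor => J' [l' _ H']; exact: (H l').
have bprec J l : down J l -> prec (below J l) J.
  move=> Jl; exists l => // x [y [_ yl] [->//|xy]]; exact: tr xy yl.
(* The guard [down J (en (down J) k)] confines the recursive calls to pieces of [J], also where [en]
   takes an arbitrary value. *)
have [||col colE] := @wf_rec (set I) (set K) prec
  (fun J f u => u = enc (tag J) (fun k b => down J (en (down J) k) /\ f (below J (en (down J) k)) b)) set0 precwf.
- move=> J g g' u gg' ->; congr enc; apply/funext => k; apply/funext => b; apply/propext.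
  by split=> -[D H]; split=> //; [rewrite -gg'|rewrite gg'] => //; exact: bprec.
- by move=> J g; eexists.
exists col => J; elim/(well_founded_ind precwf): J => J IH J' JJ' J'K.
rewrite (colE J) (colE J') => /enci[etag epc].
have JK : J #<= [set: K] by apply: card_le_trans (subset_card_le JJ') J'K.
have tagP L : L #<= [set: K] -> transported lt L (tag L).
  by move=> LK; apply: selP; exact: (transported_ex lt k0 LK).
have eD : down J = down J'.
  apply/seteqP; split=> x [y Jy xy]; first by exists y => //; exact: JJ'.
  have [z Jz yz] := transported_cofinal w (tagP _ JK) (eq_ind_r (transported lt J') (tagP _ J'K) etag) JJ' Jy.
  exists z => //; case: xy => [->//|xy]; right; case: yz => [<-//|]; exact: tr.
apply/seteqP; split=> // x Jx'.
have Dx : down J x by rewrite eD; exists x => //; left.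
have [j0 Jj0 _] := Dx.
have [enD encof] : cof (down J) (en (down J)).
  apply: selP2.
  have [e _ ei] := card_le_ex k0 JK.
  exists (fun k => if pselect (exists2 y, J y & e y = k) is left hh then s2val (cid2 hh) else j0).
  split=> [k|y [z Jz yz]].
    by case: pselect => [hh|_]; [case: cid2 => z /= Jz _; exists z => //; left|exists j0 => //; left].
  exists (e z); case: pselect => [hh|n]; last by exfalso; apply: n; exists z.
  by case: cid2 => z' /= Jz' /(ei _ _ (mem_set Jz') (mem_set Jz)) ->.
have [[k xk]|nk] := pselect (exists k, lt x (en (down J) k)).
  suff : below J (en (down J) k) x by case.
  rewrite (IH _ (bprec _ _ (enD k)) (below J' (en (down J) k))).
  - by split.
  - by move=> y [Jy yl]; split=> //; exact: JJ'.
  - by apply: card_le_trans J'K; apply: subset_card_le => y [].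
  - apply/funext => b; apply/propext; have := congr1 (fun F => F k b) epc; rewrite /= -eD => E.
    split=> H.
      by have : down J (en (down J) k) /\ col (below J (en (down J) k)) b by []; rewrite E => -[].
    by have : down J (en (down J) k) /\ col (below J' (en (down J) k)) b by []; rewrite -E => -[].
(* No term of the cofinal sequence lies above [x], so [x] is the greatest point of the downward
   closure and belongs to [J]. *)
have [z Jz xz] := Dx.
have Dz : down J z by exists z => //; left.
have [k zk] := encof z Dz.
case: xz => [->//|xz]; exfalso; apply: nk; exists k.
by case: zk => [<-//|]; exact: tr.
Qed.

(** * Noetherian families *)

Lemma ltn_well_founded : well_founded (fun m n : nat => (m < n)%N).
Proof.
suff H n : forall m, (m < n)%N -> Acc (fun m n : nat => (m < n)%N) m by move=> n; exact: (H n.+1).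
elim: n => [m|n IH m mn]; first by rewrite ltn0.
by constructor => k km; apply: IH; rewrite ltnS in mn; exact: (leq_trans km mn).
Qed.

Lemma strict_chain_sub T (f : nat -> set T) : (forall n, f n `<` f n.+1) ->
  forall n m, (n <= m)%N -> f n `<=` f m.
Proof.
move=> fS n; elim=> [|m IH]; first by rewrite leqn0 => /eqP->.
rewrite leq_eqVlt => /orP[/eqP->//|/IH nm].
by apply: subset_trans nm _; exact: properW (fS m).
Qed.

Lemma noeth_sub T (B B' : set (set T)) :
  B' `<=` B -> noetherian_family B -> noetherian_family B'.
Proof. by move=> BB nB [f [fB fS]]; apply: nB; exists f; split=> // n; exact: BB. Qed.

Lemma noeth_set1 T (V : set T) : noetherian_family [set V].
Proof. by move=> [f [fB /(_ 0%N)]]; rewrite (fB 0%N) (fB 1%N) => -[]. Qed.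

(** A chain in the union is eventually in [B'] or returns to [B] infinitely often. *)
Lemma noethU T (B B' : set (set T)) :
  noetherian_family B -> noetherian_family B' -> noetherian_family (B `|` B').
Proof.
move=> nB nB' [f [fB fS]].
have [[n0 hn0]|hn] := pselect (exists n0, forall n, (n0 <= n)%N -> B' (f n)).
  apply: nB'; exists (fun n => f (n0 + n)%N); split=> n; first by apply: hn0; rewrite leq_addr.
  by rewrite addnS.
have nx n : exists m, (n <= m)%N /\ B (f m).
  apply: contrapT => nm; apply: hn; exists n => m nlem; have [Bm|//] := fB m.
  by exfalso; apply: nm; exists m.
have [g gP] := choice nx.
pose h := fix h n := if n is n'.+1 then g (h n').+1 else g 0%N.
apply: nB; exists (f \o h); split=> [[|n]|n].
- by have [] := gP 0%N.
- by have [] := gP (h n).+1.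
rewrite /=; split; last first.
  move=> H; have [_] := fS (h n); apply; apply: subset_trans H.
  by apply: strict_chain_sub => //; have [] := gP (h n).+1.
by apply: strict_chain_sub => //; apply: ltnW; have [] := gP (h n).+1.
Qed.

(** The rank cannot grow along a chain, so it is constant from its least value on. *)
Lemma noeth_rank T S (lt : S -> S -> Prop) (r : set T -> S) (B : set (set T)) :
  well_founded lt -> (forall x y, [\/ lt x y, x = y | lt y x]) ->
  (forall U V, B U -> B V -> U `<=` V -> ~ lt (r U) (r V)) ->
  (forall s, noetherian_family [set U | B U /\ r U = s]) -> noetherian_family B.
Proof.
move=> wf tot mono nB [f [fB fS]].
have [s [n0 _ n0s] smin] := wf_min (A := range (r \o f)) wf (ex_intro _ (r (f 0%N)) (ex_intro2 _ _ 0%N I erefl)).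
apply: (nB s); exists (fun n => f (n0 + n)%N); split=> n; last by rewrite addnS.
split => //; have [lt1|//|lt1] := tot (r (f (n0 + n)%N)) s.
  by exfalso; apply: (smin _ _ lt1); exists (n0 + n)%N.
rewrite -n0s in lt1; exfalso; apply: mono lt1 => //; apply: strict_chain_sub => //; exact: leq_addr.
Qed.

(** * Regular open sets *)

Section Topology.
Variable X : topologicalType.
Implicit Types (U V W : set X) (p : X).

Definition ro U := interior (closure U) = U.

Lemma ro_open U : ro U -> open U.
Proof. by move=> <-; exact: open_interior. Qed.

Lemma open_disj_closure U A : open U -> U `&` A = set0 -> U `&` closure A = set0.
Proof.
move=> oU UA; apply/seteqP; split => // x [Ux Ax].
have [y [Ay Uy]] := Ax U (open_nbhs_nbhs (conj oU Ux)).
by have : set0 y by rewrite -UA.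
Qed.

Lemma open_meets_closure U A : open U -> U `&` closure A !=set0 -> U `&` A !=set0.
Proof.
move=> oU [x [Ux Ax]]; have [y [Ay Uy]] := Ax U (open_nbhs_nbhs (conj oU Ux)).
by exists y.
Qed.

Lemma open_sub_interior U A : open U -> U `<=` A -> U `<=` interior A.
Proof. by move=> oU; rewrite -open_subsetE. Qed.

Lemma ro_sub U V : open U -> ro V -> U `<=` closure V -> U `<=` V.
Proof. by move=> oU rV UV; rewrite -rV; exact: open_sub_interior. Qed.

Lemma ro_interior_closure A : ro (interior (closure A)).
Proof.
apply/seteqP; split; last first.
  apply: open_sub_interior; [exact: open_interior|exact: subset_closure].
apply: interiorS; rewrite [X in _ `<=` X](closure_id _).1; last exact: closed_closure.
by apply: closureS; exact: interior_subset.
Qed.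

Lemma open_setD_closure U (R : set X) : open U -> open (U `\` closure R).
Proof. by move=> oU; apply: openI => //; exact/closed_openC/closed_closure. Qed.

(** The closure of the difference misses the open set [R] up to its boundary, so the interior of
    that closure misses [R] and hence [closure R]. *)
Lemma ro_setD_closure U (R : set X) : ro U -> open R -> ro (U `\` closure R).
Proof.
move=> rU oR; apply/seteqP; split; last first.
  by apply: open_sub_interior; [exact/open_setD_closure/ro_open|exact: subset_closure].
move=> x Hx; split.
  by move: Hx; rewrite -[X in _ -> X x]rU; apply: interiorS; apply: closureS => y [].
suff : interior (closure (U `\` closure R)) `&` closure R = set0.
  by move=> E Rx; have : set0 x by rewrite -E.
apply: open_disj_closure; first exact: open_interior.
rewrite setIC; apply/seteqP; split=> // y [Ry /interior_subset Hy].
suff : R `&` closure (U `\` closure R) = set0 by move=> E; rewrite -E; split.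
apply: open_disj_closure => //; apply/seteqP; split=> // z [Rz [_]].
by apply; exact: subset_closure.
Qed.

Hypotheses (T1 : accessible_space X) (Treg : regular_space X).

Lemma regular_shrink V p : open V -> V p ->
  exists U, [/\ ro U, U p & closure U `<=` V].
Proof.
move=> oV Vp; have [N Np NV] := Treg (open_nbhs_nbhs (conj oV Vp)).
exists (interior (closure N)); split.
- exact: ro_interior_closure.
- have : interior N p by [].
  by apply: interiorS; exact: subset_closure.
- apply: subset_trans NV; rewrite [X in _ `<=` X](closure_id _).1; last exact: closed_closure.
  by apply: closureS; exact: interior_subset.
Qed.

Lemma regular_sub V p : open V -> V p -> exists U, [/\ ro U, U p & U `<=` V].
Proof.
move=> oV Vp; have [U [rU Up UV]] := regular_shrink oV Vp.
by exists U; split=> //; apply: subset_trans UV; exact: subset_closure.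
Qed.

Lemma separate_points W a b : open W -> W a -> W b -> a <> b ->
  exists Va Vb, [/\ [/\ open Va, Va a & closure Va `<=` W],
    [/\ open Vb, Vb b & closure Vb `<=` W] & closure Va `&` closure Vb = set0].
Proof.
move=> oW Wa Wb /eqP ab; have [G [oG Ga nGb]] := T1 ab.
have [Va [rVa Vxa VaG]] := regular_shrink (openI oG oW) (conj (set_mem Ga) Wa).
have Vab : (W `\` closure Va) b.
  by split=> // /VaG[Gb _]; move/set_mem: nGb; apply.
have [Vb [rVb Vbb VbO]] := regular_shrink (open_setD_closure Va oW) Vab.
exists Va, Vb; split.
- by split=> //; [exact: ro_open|move=> x /VaG[]].
- by split=> //; [exact: ro_open|move=> x /VbO[]].
- by apply/seteqP; split=> // x [ax /VbO[_]].
Qed.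

Definition limit_pt (A : set X) p :=
  forall V, open V -> V p -> infinite_set (V `&` A).

Lemma isolatedP A p : A p -> ~ limit_pt A p ->
  exists V, [/\ open V, V p & V `&` A `<=` [set p]].
Proof.
move=> Ap /existsNP[V /not_implyP[oV /not_implyP[Vp /contrapT finVA]]].
exists (V `\` ((V `&` A) `\ p)); split.
- apply: openI => //; apply: closed_openC.
  by apply: ((@accessible_finite_set_closed X).1 T1); exact: finite_setD.
- by split=> // -[_]; apply.
- by move=> x [[Vx nx] Ax]; apply: contrapT => xp; apply: nx; split.
Qed.

(** Take two points of [A] with neighbourhoods of disjoint closures. The complements of these
    closures cover [W], so one of them contains infinitely many points of [A] in [W]. *)
Lemma split_infinite A W : open W -> infinite_set (W `&` A) ->
  exists V W', [/\ open V, open W', V `<=` W, W' `<=` W &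
    [/\ V `&` A !=set0, infinite_set (W' `&` A) & W' `&` closure V = set0]].
Proof.
move=> oW infW.
have [a [Wa Aa]] := infinite_setN0 infW.
have [b [[Wb Ab] nba]] : (W `&` A) `\ a !=set0.
  apply: (@infinite_setN0 _ _); move=> fin; apply: infW.
  apply: (@sub_finite_set _ _ ((W `&` A) `\ a `|` [set a])).
    by move=> x xWA; have [->|nxa] := pselect (x = a); [right|left].
  by rewrite finite_setU; split=> //; exact: finite_set1.
have [Va [Vb [[oVa Vaa VaW] [oVb Vbb VbW] dis]]] :=
  separate_points oW Wa Wb (fun e => nba (esym e)).
have [finA|infA] := pselect (finite_set ((W `\` closure Va) `&` A)); last first.
  exists Va, (W `\` closure Va); split=> //.
  - exact: open_setD_closure.
  - by apply: subset_trans VaW; exact: subset_closure.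
  - split=> //; first by exists a.
    by apply/seteqP; split=> // x [[]].
exists Vb, (W `\` closure Vb); split=> //.
- exact: open_setD_closure.
- by apply: subset_trans VbW; exact: subset_closure.
- split; first by exists b.
  + move=> finB; apply: infW.
    apply: (@sub_finite_set _ _ (((W `\` closure Va) `&` A) `|` ((W `\` closure Vb) `&` A))).
      move=> x [Wx Ax]; have [xa|nxa] := pselect (closure Va x); last by left.
      right; split=> //; split=> // xb.
      by have : (closure Va `&` closure Vb) x by []; rewrite dis.
    by rewrite finite_setU.
  + by apply/seteqP; split=> // x [[]].
Qed.

(** Split twice. A deletion will have to spare a given point, and this point lies in at most one of
    the two disjoint closures. The second set is shrunk to keep its closure inside [V2]. *)
Lemma split_infinite2 A W : open W -> infinite_set (W `&` A) ->
  exists W' (E : bool -> set X), [/\ open W', W' `<=` W, infinite_set (W' `&` A),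
    (forall b, [/\ open (E b), E b `<=` W, E b `&` A !=set0 & W' `&` closure (E b) = set0]) &
    closure (E true) `&` closure (E false) = set0].
Proof.
move=> oW infW.
have [V1 [W1 [oV1 oW1 VW1 WW1 [V1A W1A dis1]]]] := split_infinite oW infW.
have [V2 [W2 [oV2 oW2 VW2 WW2 [[a [V2a Aa]] W2A dis2]]]] := split_infinite oW1 W1A.
have [E [rE Ea EV2]] := regular_shrink oV2 V2a.
have EV2' : E `<=` V2 by apply: subset_trans EV2; exact: subset_closure.
exists W2, (fun b => if b then V1 else E); split=> //.
- exact: subset_trans WW1.
- case; split=> //.
  + by apply/seteqP; split=> // x [/WW2 W1x ?]; rewrite -dis1.
  + exact: ro_open.
  + by apply: subset_trans EV2' _; apply: subset_trans VW2 _.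
  + by exists a.
  + apply/seteqP; split=> // x [W2x /EV2 V2x]; rewrite -dis2; split=> //.
    exact: subset_closure.
- by apply/seteqP; split=> // x [V1x /EV2/VW2 W1x]; rewrite -dis1.
Qed.

Lemma infinite_blocks A W : open W -> infinite_set (W `&` A) ->
  exists (w : nat -> set X) (E : nat -> bool -> set X), [/\ w 0%N = W,
    (forall n, open (w n) /\ w n.+1 `<=` w n),
    (forall n b, [/\ open (E n b), E n b `<=` w n, E n b `&` A !=set0 &
      w n.+1 `&` closure (E n b) = set0]) &
    (forall n, closure (E n true) `&` closure (E n false) = set0)].
Proof.
move=> oW infW.
have step : forall V, exists WE : set X * (bool -> set X), open V -> infinite_set (V `&` A) ->
   [/\ open WE.1, WE.1 `<=` V, infinite_set (WE.1 `&` A),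
    (forall b, [/\ open (WE.2 b), WE.2 b `<=` V, WE.2 b `&` A !=set0 & WE.1 `&` closure (WE.2 b) = set0]) &
    closure (WE.2 true) `&` closure (WE.2 false) = set0].
  move=> V; have [[oV iV]|nV] := pselect (open V /\ infinite_set (V `&` A)); last first.
    by exists (V, fun=> V) => oV iV; exfalso; apply: nV.
  by have [W' [E H]] := split_infinite2 oV iV; exists (W', E).
have [st stP] := choice step.
pose w n := iter n (fun V => (st V).1) W.
have wP n : open (w n) /\ infinite_set (w n `&` A).
  by elim: n => // n [ow iw]; have [] := stP _ ow iw.
exists w, (fun n => (st (w n)).2); split=> // n; have [ow iw] := wP n; have [] := stP _ ow iw => //.
Qed.

(** * Coding labels *)

(** Incomparability is modulo closures because closures are deleted: for distinct labels, some point
    of [R l] survives the deletion of [closure (R m)]. *)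
Definition code LT (L : set LT) V (R : LT -> set X) :=
  (forall l, L l -> open (R l) /\ R l `<=` V) /\
  (forall l m, L l -> L m -> R l `<=` closure (R m) -> l = m).

Definition codes LT V (L : set LT) := exists R, code L V R.

(** Let a chain start with label [l0]. A later member with label [l] misses [R l], hence so does the
    first one; thus [R l] lies in [closure (R l0)] and [l = l0]. Regular openness then makes the
    sets [U] themselves a chain. *)
Lemma noeth_coded LT (L : set LT) V (R : LT -> set X) (B : LT -> set (set X)) :
  code L V R -> (forall l, L l -> B l `<=` ro /\ noetherian_family (B l)) ->
  noetherian_family [set U' | exists l U, [/\ L l, B l U, V `<=` U & U' = U `\` closure (R l)]].
Proof.
move=> [RV Ranti] HB [f [fB fS]].
have [l0 [U0 [Ll0 BU0 VU0 fE0]]] := fB 0%N.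
have lab n : exists U, [/\ B l0 U, V `<=` U & f n = U `\` closure (R l0)].
  have [l [U [Ll BU VU fE]]] := fB n.
  suff -> : l0 = l by exists U.
  apply/esym; apply: Ranti => // x Rx; apply: contrapT => nx.
  have [oR RlV] := RV l Ll.
  have : f 0%N x by rewrite fE0; split=> //; apply/VU0/RlV.
  move=> /(strict_chain_sub fS (leq0n n)); rewrite fE => -[_]; apply.
  exact: subset_closure.
have [g gP] := choice lab.
have [BR nB] := HB l0 Ll0.
have [oR RlV] := RV l0 Ll0.
apply: nB; exists g; split=> n; first by have [] := gP n.
have [Bn Vn fn] := gP n; have [Bn1 Vn1 fn1] := gP n.+1.
have [fsub fne] := fS n.
split; last first.
  by move=> H; apply: fne; rewrite fn fn1 => x [/H].
apply: ro_sub; [exact/ro_open/BR|exact: BR|].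
move=> x gx; have [Rx|nRx] := pselect (closure (R l0) x).
  by apply: closureS Rx; exact: subset_trans Vn1.
have : f n x by rewrite fn.
by move=> /fsub; rewrite fn1 => -[/subset_closure].
Qed.

(* The label of [U] is stored by deleting some [closure (R l)] inside the first
   block [w W n] contained in [U], for a well-ordered list of the sets [W] and
   nested blocks in each of them. The next block survives the deletion, so the
   place of the deletion can be read off from the result up to four choices. *)
Lemma coding LT (L : set LT) (A : set X) (P : set (set X)) (B : LT -> set (set X)) :
  P `<=` ro ->
  (forall a V, A a -> open V -> V a -> exists2 R, code L V R &
     forall l U, L l -> P U -> V `<=` U -> P (U `\` closure (R l))) ->
  (forall l, L l -> B l `<=` P /\ noetherian_family (B l)) ->
  exists B', [/\ B' `<=` P, noetherian_family B' &
    forall l U p, L l -> B l U -> U p -> limit_pt A p ->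
      exists U', [/\ B' U', U' p & U' `<=` U]].
Proof.
move=> Pro HA HB.
pose good W := open W /\ infinite_set (W `&` A).
have ex1 : forall W, exists t : (nat -> set X) * (nat -> bool -> set X) * (nat -> bool -> LT -> set X),
   good W -> [/\ t.1.1 0%N = W, (forall n, t.1.1 n.+1 `<=` t.1.1 n),
    (forall n b, t.1.2 n b `<=` t.1.1 n /\ t.1.1 n.+1 `&` closure (t.1.2 n b) = set0),
    (forall n, closure (t.1.2 n true) `&` closure (t.1.2 n false) = set0) &
    (forall n b, code L (t.1.2 n b) (t.2 n b) /\ forall l U, L l -> P U -> t.1.2 n b `<=` U -> P (U `\` closure (t.2 n b l)))].
  move=> W; have [[oW iW]|nW] := pselect (good W); last by exists ((fun=>set0), (fun _ _ => set0), fun _ _ _ => set0).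
  have [w [E [w0 wP EP dis]]] := infinite_blocks oW iW.
  have ex2 (nb : nat * bool) : exists R, code L (E nb.1 nb.2) R /\
     forall l U, L l -> P U -> E nb.1 nb.2 `<=` U -> P (U `\` closure (R l)).
    have [oE _ [a [Ea Aa]] _] := EP nb.1 nb.2.
    by have [R RP RP'] := HA a _ Aa oE Ea; exists R.
  have [R RP] := choice ex2.
  exists (w, E, fun n b => R (n, b)); split=> //= n.
  - by have [] := wP n.
  - by move=> b; have [] := EP n b.
  - by move=> b; exact: (RP (n, b)).
have [t tP] := choice ex1.
pose w W := (t W).1.1; pose E W := (t W).1.2; pose R W := (t W).2.
have [lt ltw] := exists_wo (set X); have [wf tr tot] := ltw.
(* [alpha U] will be the first set with a block inside [U], and [nu U] the first index of such a
   block. *)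
pose cand U W := good W /\ exists n, w W n `<=` U.
have exa : forall U, exists W, (exists W, cand U W) -> cand U W /\ forall W', cand U W' -> ~ lt W' W.
  move=> U; have [h|n] := pselect (exists W, cand U W); last by exists set0.
  by have [W cW mW] := wf_min wf h; exists W.
have [alpha aP] := choice exa.
have exn : forall U, exists n, (exists W, cand U W) -> w (alpha U) n `<=` U /\ forall m, w (alpha U) m `<=` U -> (n <= m)%N.
  move=> U; have [h|n] := pselect (exists W, cand U W); last by exists 0%N.
  have [[_ [n0 hn0]] _] := aP U h.
  have [n hn mn] := @wf_min nat _ [set n | w (alpha U) n `<=` U] ltn_well_founded (ex_intro _ n0 hn0).
  by exists n => _; split=> // m /mn /negP; rewrite -leqNgt.
have [nu nP] := choice exn.
pose B' := [set U' | exists b l U, [/\ (exists W, cand U W), L l, B l U &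
   U' = U `\` closure (R (alpha U) (nu U) b l)]].
(* The deletion creates no candidates and keeps the block after [nu U], so [alpha] is unchanged and
   [nu] grows by at most one. *)
have key b l U : (exists W, cand U W) -> L l -> B l U ->
   [/\ exists W, cand (U `\` closure (R (alpha U) (nu U) b l)) W,
      alpha (U `\` closure (R (alpha U) (nu U) b l)) = alpha U,
      (nu U <= nu (U `\` closure (R (alpha U) (nu U) b l)) <= (nu U).+1)%N,
      code L (E (alpha U) (nu U) b) (R (alpha U) (nu U) b) &
      E (alpha U) (nu U) b `<=` w (alpha U) (nu U) /\ w (alpha U) (nu U) `<=` U].
  move=> hU Ll BU; set U' := U `\` _.
  have [[gW _] amin] := aP U hU; have [wU nmin] := nP U hU.
  have [_ wdec Ew Edis Rcode] := tP _ gW.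
  have [[RE _] _] := Rcode (nu U) b.
  have wU' : w (alpha U) (nu U).+1 `<=` U'.
    move=> x wx; split; first exact/wU/wdec.
    move=> /(closureS (RE l Ll).2) Ex.
    by have [_ d] := Ew (nu U) b; rewrite -[False]/(set0 x) -d.
  have cU' : cand U' (alpha U) by split=> //; exists (nu U).+1.
  have hU' : exists W, cand U' W by exists (alpha U).
  have [[gW' [n' wn']] amin'] := aP U' hU'.
  have ea : alpha U' = alpha U.
    case: (tot (alpha U') (alpha U)) => // h; exfalso.
      by apply: (amin _ _ h); split=> //; exists n'; apply: subset_trans wn' _ => x [].
    exact: (amin' _ cU' h).
  have [wU'' nmin'] := nP U' hU'; rewrite ea in wU'' nmin'.
  split=> //.
  - by rewrite nmin' // nmin //; apply: subset_trans wU'' _ => x [].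
  - by have [] := Rcode (nu U) b.
  - by split=> //; have [] := Ew (nu U) b.
exists B'; split.
- move=> _ [b [l [U [hU Ll BU ->]]]].
  have [_ _ _ _ [EW wU]] := key b l U hU Ll BU.
  have [[gW _] _] := aP U hU; have [_ _ _ _ Rcode] := tP _ gW.
  have [_] := Rcode (nu U) b; apply=> //; first by have [BP _] := HB l Ll; exact: BP.
  exact: subset_trans wU.
- have candB U' : B' U' -> exists W, cand U' W.
    by move=> [b [l [U [hU Ll BU ->]]]]; have [] := key b l U hU Ll BU.
  (* A larger set has more candidates, so [alpha], and for fixed [alpha] also [nu], cannot grow
     along a chain. *)
  apply: (noeth_rank (r := alpha) wf tot).
    move=> U V /candB hU /candB hV UV; have [_ m] := aP V hV; apply: m.
    have [[gU [n wn]] _] := aP U hU; split=> //; exists n; exact: subset_trans UV.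
  move=> W; apply: (noeth_rank (r := nu) (lt := fun m n => (m < n)%N)).
  + exact: ltn_well_founded.
  + by move=> m n; have [lt1|lt1|eq1] := ltngtP m n; [constructor 1|constructor 3|constructor 2].
  + move=> U V [/candB hU aU] [/candB hV aV] UV; apply/negP; rewrite -leqNgt.
    have [wU _] := nP U hU; have [_ mV] := nP V hV; apply: mV.
    by rewrite aV -aU; exact: subset_trans UV.
  + move=> m.
    (* The second factor makes the family empty where [R W n b] is no code. *)
    pose F n b := [set U' | exists l U, [/\ L l, B l U, E W n b `<=` U &
       U' = U `\` closure (R W n b l)]] `&` [set U' | code L (E W n b) (R W n b)].
    have nF n b : noetherian_family (F n b).
      have [cd|nc] := pselect (code L (E W n b) (R W n b)); last first.
        by move=> [f [/(_ 0%N)[_ cd]]].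
      apply: (@noeth_sub _ [set U' | exists l U, [/\ L l, B l U, E W n b `<=` U &
       U' = U `\` closure (R W n b l)]]); first by move=> U' [].
      apply: noeth_coded cd _ => l Ll; have [BP nB] := HB l Ll; split=> // U BU.
      exact/Pro/BP.
    (* The deletion took place at index [m] or [m.-1], with either value of [b]. *)
    apply: (@noeth_sub _ ((F m true `|` F m false) `|` (F m.-1 true `|` F m.-1 false))).
      move=> _ [[[b [l [U [hU Ll BU ->]]]] aW] nm].
      have [_ ea en cd [EW wU]] := key b l U hU Ll BU.
      rewrite ea in aW; rewrite nm in en; rewrite aW in EW cd wU *.
      have inF : F (nu U) b (U `\` closure (R W (nu U) b l)).
        by split=> //; exists l, U; split=> //; exact: subset_trans wU.
      case/andP: en; rewrite leq_eqVlt => /orP[/eqP em|lt1] le2.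
        by left; rewrite em in inF *; case: b {cd ea nm EW} inF; [left|right].
      have em : m = (nu U).+1 by apply/eqP; rewrite eqn_leq le2 lt1.
      by right; rewrite em; case: b {cd ea nm EW} inF; [left|right].
    by apply: noethU; apply: noethU.
- move=> l U p Ll BU Up acc.
  have [BP _] := HB l Ll.
  have oU : open U by exact/ro_open/Pro/BP.
  have gU : good U by split=> //; exact: acc.
  have hU : exists W, cand U W.
    exists U; split=> //; exists 0%N; have [w0 _ _ _ _] := tP _ gU.
    by rewrite /w w0.
  have [[gW _] _] := aP U hU; have [_ _ _ Edis _] := tP _ gW.
  have [b nb] : exists b, ~ closure (E (alpha U) (nu U) b) p.
    apply: contrapT => /forallNP nb.
    have e b : closure (E (alpha U) (nu U) b) p by exact: contrapT (nb b).
    by have : (closure (E (alpha U) (nu U) true) `&` closure (E (alpha U) (nu U) false)) p by []; rewrite Edis.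
  exists (U `\` closure (R (alpha U) (nu U) b l)); split.
  + by exists b, l, U.
  + split=> // Rp; apply: nb; apply: closureS Rp.
    by have [_ _ _ [RE _] _] := key b l U hU Ll BU; have [] := RE l Ll.
  + by move=> x [].
Qed.
End Topology.

(** * Outer bases at the points of a set *)

Section NoetherianOuterBase.
Variable X : topologicalType.
Hypotheses (T1 : accessible_space X) (Treg : regular_space X).
Implicit Types (U V W : set X) (p : X).

Lemma codes_le LT LT' (L : set LT) (L' : set LT') V :
  codes V L -> L' #<= L -> codes V L'.
Proof.
move=> [R [RV Ra]] LL.
have [[l' Ll']|n] := pselect (L' !=set0); last first.
  by exists (fun=> set0); split=> [l Ll|l m Ll]; exfalso; apply: n; exists l.
have [l0 _] := card_le_neq0 LL (ex_intro _ l' Ll').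
have [f fL fi] := card_le_ex l0 LL.
exists (R \o f); split=> [l Ll|l m Ll Lm /Ra e]; first by apply: RV; exact: fL.
by apply: fi; [exact: mem_set|exact: mem_set|apply: e; exact: fL].
Qed.

Lemma codes_sub LT (L : set LT) V V' : codes V L -> V `<=` V' -> codes V' L.
Proof.
move=> [R [RV Ra]] VV; exists R; split=> // l Ll; have [oR RlV] := RV l Ll.
by split=> //; exact: subset_trans VV.
Qed.

(* A member of a disjoint family of pairs is used in full or in its twin,
   which makes the codes of different subsets of [K] incomparable. *)
Lemma codes_powerset K V (D : K * bool -> set X) :
  (forall i, [/\ open (D i), D i `<=` V & D i !=set0]) ->
  (forall i j, D i `&` D j !=set0 -> i = j) -> codes V [set: set K].
Proof.
move=> DV Ddis.
exists (fun S => \bigcup_(i in [set i : K * bool | S i.1 <-> i.2]) D i); split.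
  move=> S _; split; first by apply: bigcup_open => i _; have [] := DV i.
  by move=> x [i _ Dx]; have [_ DiV _] := DV i; exact: DiV.
have sub S S' : \bigcup_(i in [set i : K * bool | S i.1 <-> i.2]) D i `<=`
     closure (\bigcup_(i in [set i : K * bool | S' i.1 <-> i.2]) D i) ->
     forall i : K * bool, (S i.1 <-> i.2) -> (S' i.1 <-> i.2).
  move=> SS i Si; have [oD _ [x Dx]] := DV i.
  have [|y [Dy [j S'j Dj]]] := open_meets_closure oD (A := \bigcup_(i in [set i : K * bool | S' i.1 <-> i.2]) D i).
    by exists x; split=> //; apply: SS; exists i.
  by rewrite (Ddis i j) //; exists y.
move=> S S' _ _ SS; apply/funext => k; apply/propext; split=> Sk.
  by apply: (sub _ _ SS (k, true) _).2 => //; split.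
apply: contrapT => nSk; have := (sub _ _ SS (k, false) _).1; rewrite /= => H.
by have : false by apply: H => //; split.
Qed.

(** Neighbourhood bases in [X] at the points of [A]. They pass to subsets and finite unions of such
    sets, so points can be sorted by cases; regular openness permits further coding. *)
Definition noeth_outer_base (A : set X) := exists B : set (set X), [/\ B `<=` @ro X, noetherian_family B &
  forall p V, A p -> open V -> V p -> exists U, [/\ B U, U p & U `<=` V]].

Lemma noeth_outer_base_sub A A' : A' `<=` A -> noeth_outer_base A -> noeth_outer_base A'.
Proof. by move=> AA [B [Br nB HB]]; exists B; split=> // p V /AA; exact: HB. Qed.

Lemma noeth_outer_baseU A A' : noeth_outer_base A -> noeth_outer_base A' -> noeth_outer_base (A `|` A').
Proof.
move=> [B [Br nB HB]] [B' [Br' nB' HB']]; exists (B `|` B'); split.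
- by move=> U [/Br|/Br'].
- exact: noethU.
- move=> p V [Ap|Ap] oV Vp; [have [U [BU Up UV]] := HB p V Ap oV Vp|have [U [BU Up UV]] := HB' p V Ap oV Vp].
    by exists U; split=> //; left.
  by exists U; split=> //; right.
Qed.

(** Sets meeting [A] only in [p] stay attached to the same [p] along a chain. Keeping those with no
    [lt]-smaller subset of the same kind makes every chain [lt]-decreasing. *)
Lemma isolated_base (A : set X) (P : set (set X)) : exists B : set (set X),
  [/\ B `<=` P, noetherian_family B &
   forall p U, A p -> P U -> U p -> U `&` A `<=` [set p] ->
     exists U', [/\ B U', U' p & U' `<=` U]].
Proof.
have [lt ltw] := exists_wo (set X); have [wf tr tot] := ltw.
pose C p U := [/\ P U, U p & U `&` A `<=` [set p]].
pose B := [set U | exists2 p, A p & C p U /\ forall V, C p V -> V `<=` U -> ~ lt V U].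
exists B; split; first by move=> U [p _ [[]]].
  move=> [f [fB fS]].
  have [p0 Ap0 [[P0 f0p0 f0A] _]] := fB 0%N.
  have fC n : C p0 (f n) /\ forall V, C p0 V -> V `<=` f n -> ~ lt V (f n).
    have [p Ap [[Pn fp fA] m]] := fB n; suff -> : p0 = p by split.
    by apply: fA; split=> //; apply: (strict_chain_sub fS (leq0n n)).
  have [U [n _ fnU] m] := wf_min (A := range f) wf (ex_intro _ (f 0%N) (ex_intro2 _ _ 0%N I erefl)).
  have [fsub fne] := fS n.
  have [h|e|h] := tot (f n) (f n.+1).
  - by have [_ mm] := fC n.+1; apply: mm h => //; have [] := fC n.
  - by apply: fne; rewrite e.
  - by apply: (m (f n.+1)); [exists n.+1|rewrite -fnU].
move=> p U Ap PU Up UA.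
have [V [CV VU] m] := wf_min (A := [set V | C p V /\ V `<=` U]) wf (ex_intro _ U (conj (And3 PU Up UA) (@subset_refl _ U))).
exists V; split=> //; last by case: CV.
exists p => //; split=> // V' CV' V'V; apply: m; split=> //; exact: subset_trans VU.
Qed.

Lemma noeth_outer_base_isolated (A : set X) : noeth_outer_base [set p | A p /\ ~ limit_pt A p].
Proof.
have [B [Br nB HB]] := isolated_base A (@ro X).
exists B; split=> // p V [Ap nacc] oV Vp.
have [N [oN Np NA]] := isolatedP T1 Ap nacc.
have [U [rU Up UVN]] := regular_sub Treg (openI oV oN) (conj Vp Np).
have [|U' [BU' U'p U'U]] := HB p U Ap rU Up.
  by move=> x [/UVN[_ Nx] Ax]; exact: NA.
by exists U'; split=> // x /U'U/UVN[].
Qed.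

(** [coding] merges the bases for the sets [F l] at the limit points of [A]; the other points of [A]
    are isolated in [A]. *)
Lemma noeth_outer_base_coded (A : set X) LT (L : set LT) (F : LT -> set X) :
  (forall a V, A a -> open V -> V a -> codes V L) ->
  (forall l, L l -> noeth_outer_base (F l)) -> A `<=` \bigcup_(l in L) F l -> noeth_outer_base A.
Proof.
move=> HA HF AF.
have ex l : exists B : set (set X), L l -> [/\ B `<=` @ro X, noetherian_family B &
  forall p V, F l p -> open V -> V p -> exists U, [/\ B U, U p & U `<=` V]].
  have [Ll|nL] := pselect (L l); last by exists set0.
  by have [B HB] := HF l Ll; exists B.
have [B BP] := choice ex.
have [|||B' [B'r nB' HB']] := @coding X T1 Treg LT L A (@ro X) B.
- by [].
- move=> a V Aa oV Va; have [R cR] := HA a V Aa oV Va; exists R => // l U Ll rU VU.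
  by apply: ro_setD_closure => //; have [RV _] := cR; have [] := RV l Ll.
- by move=> l Ll; have [] := BP l Ll.
apply: (@noeth_outer_base_sub ([set p | A p /\ limit_pt A p] `|` [set p | A p /\ ~ limit_pt A p])).
  by move=> p Ap; have [?|?] := pselect (limit_pt A p); [left|right].
apply: noeth_outer_baseU; last exact: noeth_outer_base_isolated.
exists B'; split=> // p V [Ap acc] oV Vp.
have [l Ll Fp] := AF p Ap; have [Br nB HB] := BP l Ll.
have [U [BU Up UV]] := HB p V Fp oV Vp.
have [U' [BU' U'p U'U]] := HB' l U p Ll BU Up acc.
by exists U'; split=> //; exact: subset_trans UV.
Qed.

Lemma noeth_outer_base_isolated_points : noeth_outer_base [set p | open [set p]].
Proof.
exists [set U | exists2 p, open [set p] & U = [set p]]; split.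
- move=> _ [p op ->]; rewrite /ro -(closure_id _).1; first exact/interior_id.
  exact: accessible_closed_set1.
- move=> [f [fB fS]]; have [p _ e0] := fB 0%N; have [q _ e1] := fB 1%N.
  have [s ns] := fS 0%N; apply: ns; rewrite e0 e1 in s *.
  by move=> x ->; rewrite -(s p erefl).
- by move=> p V op oV Vp; exists [set p]; split=> //; [exists p|move=> x ->].
Qed.

Lemma not_isolated_infinite p V : ~ open [set p] -> open V -> V p -> infinite_set V.
Proof.
move=> np oV Vp finV; apply: np.
have -> : [set p] = V `\` (V `\ p).
  by apply/seteqP; split=> [x ->|x [Vx nx]]; [split=> // -[_]; apply|apply: contrapT => xp; apply: nx].
apply: openI => //; apply: closed_openC.
by apply: ((@accessible_finite_set_closed X).1 T1); exact: finite_setD.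
Qed.

(** The blocks in [V] supply a disjoint pair [E n true], [E n false] for each [n], as
    [codes_powerset] requires. *)
Lemma not_isolated_codes p V : ~ open [set p] -> open V -> V p -> codes V [set: set nat].
Proof.
move=> np oV Vp; have := not_isolated_infinite np oV Vp; rewrite -{1}(setIT V) => iV.
have [w [E [w0 wP EP dis]]] := infinite_blocks T1 Treg oV iV.
have wsub n m : (n <= m)%N -> w m `<=` w n.
  elim: m => [|m IH]; first by rewrite leqn0 => /eqP->.
  rewrite leq_eqVlt => /orP[/eqP->//|/IH]; apply: subset_trans.
  by have [] := wP m.
have Edis n m b c : (n < m)%N -> E n b `&` E m c = set0.
  move=> nm; have [_ Ew _ _] := EP m c; have [_ _ _ d] := EP n b.
  apply/seteqP; split=> // x [Ex /Ew /(wsub _ _ nm) wx]; rewrite -d; split=> //.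
  exact: subset_closure.
have Edis2 n : E n true `&` E n false = set0.
  by apply/seteqP; split=> // x [/subset_closure Ex /subset_closure Ex']; rewrite -(dis n).
apply: (@codes_powerset _ _ (fun i => E i.1 i.2)).
  move=> [n b] /=; have [oE Ew [a [Ea _]] _] := EP n b; split=> //; last by exists a.
  by rewrite -w0; apply: subset_trans Ew _; exact: wsub.
move=> [n b] [m c] /= [x [Ex Ex']].
have H A : A = set0 -> ~ A x by move=> ->.
case: (ltngtP n m) => [nm|mn|e]; first by case: (H _ (Edis n m b c nm)).
  by case: (H _ (Edis m n c b mn)).
subst m; case: b c Ex Ex' => -[] // Ex Ex'; by case: (H _ (Edis2 n)).
Qed.

Lemma card_le_powerset K : [set: K] #<= [set: set K].
Proof.
apply: (card_le_fun (f := fun k : K => [set k])) => [//|x y _ _ e].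
by have : [set y] x by rewrite -e.
Qed.

End NoetherianOuterBase.

(** * Self-coding cells *)

Section Cells.
Variable X : topologicalType.
Hypotheses (T1 : accessible_space X) (Treg : regular_space X).
Implicit Types (U V W : set X) (p : X).

(** A label is a function on [J] whose value at [i] is coded inside [D i]. The sets [D i] are open
    and disjoint, so closures can be compared in each [D i] separately. The last two clauses serve
    to control supports after a deletion. *)
Lemma code_product I LT MT (J : set I) (D : I -> set X) (M : I -> set MT)
    (L : set LT) (phi : LT -> I -> MT) V :
  (forall i, J i -> [/\ open (D i), D i `<=` V & codes (D i) (M i)]) ->
  (forall i j, J i -> J j -> D i `&` D j !=set0 -> i = j) ->
  (forall l i, L l -> J i -> M i (phi l i)) ->
  (forall l l', L l -> L l' -> (forall i, J i -> phi l i = phi l' i) -> l = l') ->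
  exists R, [/\ code L V R, (forall l, L l -> R l `<=` \bigcup_(i in J) D i) &
    forall l i, L l -> J i -> (exists2 m, M i m & m <> phi l i) ->
      ~ (D i `<=` closure (R l))].
Proof.
move=> HD Ddis Mphi phiinj.
have ex i : exists r : MT -> set X, J i -> code (M i) (D i) r.
  by have [Ji|nJ] := pselect (J i); [have [_ _ [r cr]] := HD i Ji; exists r|exists (fun=> set0)].
have [r rP] := choice ex.
pose R l := \bigcup_(i in J) r i (phi l i).
have rD i m : J i -> M i m -> r i m `<=` D i.
  by move=> Ji Mm; have [H _] := rP i Ji; have [] := H m Mm.
have ro i m : J i -> M i m -> open (r i m).
  by move=> Ji Mm; have [H _] := rP i Ji; have [] := H m Mm.
have loc l i : L l -> J i -> D i `&` closure (R l) `<=` closure (r i (phi l i)).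
  move=> Ll Ji x [Dx Rx] N Nx; have [oD _ _] := HD i Ji.
  have [y [[j Jj rj] [Dy Ny]]] := Rx (D i `&` N) (filterI (open_nbhs_nbhs (conj oD Dx)) Nx).
  suff e : i = j by exists y; subst j.
  by apply: Ddis => //; exists y; split=> //; apply: rD rj => //; exact: Mphi.
exists R; split.
- split=> [l Ll|l l' Ll Ll' RR].
    split; first by apply: bigcup_open => i Ji; apply: ro => //; exact: Mphi.
    move=> x [i Ji rx]; have [_ DV _] := HD i Ji; apply: DV; apply: rD rx => //; exact: Mphi.
  apply: phiinj => // i Ji; have [_ ra] := rP i Ji; apply: ra; try exact: Mphi.
  move=> x rx; apply: loc => //; split; first by apply: rD rx => //; exact: Mphi.
  by apply: RR; exists i.
- by move=> l Ll x [i Ji rx]; exists i => //; apply: rD rx => //; exact: Mphi.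
- move=> l i Ll Ji [m Mm mne] DR; apply: mne; have [_ ra] := rP i Ji.
  apply: ra => //; first exact: Mphi.
  by move=> x rx; apply: loc => //; have Dx := rD _ _ Ji Mm _ rx; split=> //; exact: DR.
Qed.

(** [V0] codes [t] and [V1] codes [l]. As [V0] and [V1] are disjoint and open, an inclusion splits
    in two: the first half gives equal [t], and then the second concerns a single code. *)
Lemma code_sigma T LT (K : set T) (L : T -> set LT) V V0 V1 :
  open V0 -> open V1 -> V0 `<=` V -> V1 `<=` V -> V0 `&` V1 = set0 ->
  codes V0 K -> (forall t, K t -> codes V1 (L t)) ->
  codes V [set tl : T * LT | K tl.1 /\ L tl.1 tl.2].
Proof.
move=> oV0 oV1 V0V V1V dis [R0 [R0P R0a]] HL.
have ex t : exists r : LT -> set X, K t -> code (L t) V1 r.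
  by have [Kt|nK] := pselect (K t); [have [r cr] := HL t Kt; exists r|exists (fun=> set0)].
have [r rP] := choice ex.
have d0 A : A `<=` V1 -> V0 `&` closure A = set0.
  move=> AV; apply: open_disj_closure => //; apply/seteqP; split=> // x [V0x /AV V1x].
  by rewrite -dis.
have d1 A : A `<=` V0 -> V1 `&` closure A = set0.
  move=> AV; apply: open_disj_closure => //; apply/seteqP; split=> // x [V0x /AV V1x].
  by rewrite -dis.
exists (fun tl => R0 tl.1 `|` r tl.1 tl.2); split.
  move=> [t l] [/= Kt Ll]; have [op0 s0] := R0P t Kt; have [rp _] := rP t Kt; have [op1 s1] := rp l Ll.
  split; first exact: openU.
  by move=> x [/s0/V0V|/s1/V1V].
move=> [t l] [t' l'] [/= Kt Ll] [/= Kt' Ll'] RR.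
have [op0 s0] := R0P t Kt; have [rp _] := rP t Kt; have [op1 s1] := rp l Ll.
have [op0' s0'] := R0P t' Kt'; have [rp' _] := rP t' Kt'; have [op1' s1'] := rp' l' Ll'.
have et : t = t'.
  apply: R0a => // x Rx; have : closure (R0 t' `|` r t' l') x by apply: RR; left.
  rewrite closureU => -[//|Cx]; suff : set0 x by [].
  by rewrite -(d0 _ s1'); split=> //; exact: s0.
subst t'; congr pair; have [_ ra] := rP t Kt; apply: ra => // x rx.
have : closure (R0 t `|` r t l') x by apply: RR; right.
rewrite closureU => -[Cx|//]; suff : set0 x by [].
by rewrite -(d1 _ s0'); split=> //; exact: s1.
Qed.

Definition trace_ro (O : set X) : set (set X) := [set u | exists2 V, ro V & u = V `&` O].

Definition self_coding (O : set X) :=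
  forall V, open V -> V `<=` O -> V !=set0 -> codes V (trace_ro O).

Definition cell (O : set X) :=
  [/\ open O, O !=set0 & (exists x, O = [set x]) \/ self_coding O].

Lemma crowded_split V : open V -> V !=set0 -> (forall x, V x -> ~ open [set x]) ->
  exists V0 V1, [/\ open V0, open V1, V0 `<=` V, V1 `<=` V &
    [/\ V0 !=set0, V1 !=set0 & V0 `&` V1 = set0]].
Proof.
move=> oV [a Va] nV.
have [b [Vb ba]] : V `\ a !=set0.
  apply: contrapT => n; apply: (nV a Va); suff <- : V = [set a] by [].
  apply/seteqP; split=> [x Vx|x ->//]; apply: contrapT => xa; apply: n; by exists x.
have [Va' [Vb' [[oA Aa AV] [oB Bb BV] dis]]] := separate_points T1 Treg oV Va Vb (fun e => ba (esym e)).
exists Va', Vb'; split=> //.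
- by apply: subset_trans AV; exact: subset_closure.
- by apply: subset_trans BV; exact: subset_closure.
- split; [by exists a|by exists b|].
  by apply/seteqP; split=> // x [/subset_closure ? /subset_closure ?]; rewrite -dis.
Qed.

(* [K0] plays the role of the least cardinal that [O] does not code. *)
Section Homogeneous.
Variables (O : set X) (K0 : set (set X)).
Hypotheses (oO : open O) (O0 : O !=set0) (crowded : forall x, O x -> ~ open [set x]).
Hypothesis K0ncode : ~ codes O K0.
Hypothesis K0min : forall LT (L : set LT) V, open V -> V `<=` O -> V !=set0 ->
  ~ (K0 #<= L) -> codes V L.

(** Together with [K0min] this is homogeneity: labels coded in some subset of [O] are coded in every
    nonempty open subset of [O]. *)
Lemma codes_small LT (L : set LT) V : V `<=` O -> codes V L -> ~ (K0 #<= L).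
Proof. by move=> VO cL K0L; apply: K0ncode; apply: codes_le K0L; exact: codes_sub VO. Qed.

Definition pibase (V : set X) (P : set (set X)) :=
  (forall D, P D -> [/\ open D, D `<=` V & D !=set0]) /\
  forall U, open U -> U `<=` V -> U !=set0 -> exists2 D, P D & D `<=` U.

(** The earlier terms are fewer than [K0], hence no pi-base of [V]; the next term is chosen inside
    an open set that contains none of them. *)
Lemma greedy_free (lt : set X -> set X -> Prop) (K1 : set (set X)) V : wo lt ->
  K0 #<= K1 -> (forall y, K1 y -> ~ (K1 #<= [set z | K1 z /\ lt z y])) -> K1 #<= K0 ->
  open V -> (forall P, pibase V P -> K0 #<= P) ->
  exists a : set X -> set X, forall y, K1 y ->
    [/\ ro (a y), a y `<=` V & forall z, K1 z -> lt z y -> ~ (a z `<=` a y)].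
Proof.
move=> ltw K01 K1i K10 oV nP; have [wf tr tot] := ltw.
pose good (u : set X) := [/\ ro u, u `<=` V & u !=set0].
(* Since [g] is arbitrary during the recursion, only its good values are taken into account. *)
have [||a aP] := @wf_rec (set X) (set X) lt (fun y g u => K1 y ->
    good u /\ forall z, K1 z -> lt z y -> good (g z) -> ~ (g z `<=` u)) set0 wf.
- move=> y g g' u gg' H K1y; have [gu Hu] := H K1y; split=> // z K1z zy.
  by rewrite -gg' //; exact: Hu.
- move=> y g; have [K1y|] := pselect (K1 y); last by exists set0.
  pose P := [set u | exists2 z, K1 z /\ lt z y & g z = u /\ good u].
  have PK : P #<= [set z | K1 z /\ lt z y].
    apply: card_le_trans (card_image_le g _); apply: subset_card_le.
    by move=> u [z Kz [gz _]]; exists z.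
  have nPb : ~ pibase V P.
    move=> /nP K0P; apply: (K1i y K1y); apply: card_le_trans K10 _; exact: card_le_trans PK.
  have [U [oU UV U0 UP]] : exists U, [/\ open U, U `<=` V, U !=set0 & forall D, P D -> ~ (D `<=` U)].
    apply: contrapT => n; apply: nPb; split.
      by move=> D [z _ [_ [rD DV D0]]]; split=> //; exact: ro_open.
    move=> U oU UV U0; apply: contrapT => n'; apply: n; exists U; split=> // D PD DU.
    by apply: n'; exists D.
  have [x Ux] := U0; have [u [ru ux uU]] := regular_sub Treg oU Ux.
  exists u => _; split; first by split=> //; [exact: subset_trans UV|exists x].
  move=> z K1z zy gz gu; apply: (UP (g z)); first by exists z.
  exact: subset_trans uU.
exists a => y K1y; have [[r s n] H] := aP y K1y; split=> // z K1z zy; apply: H => //.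
by have [] := aP z K1z.
Qed.

(* Otherwise two greedy sequences in disjoint sets [V0] and [V1], in which no term
   contains an earlier one, would code [K0]: in [a y `|` (V1 `\` closure (e y))]
   the first part excludes one inclusion and the second one the other. *)
Lemma small_pibase : exists V P, [/\ open V, V `<=` O, V !=set0, pibase V P & ~ (K0 #<= P)].
Proof.
apply: contrapT => n.
have nP V : open V -> V `<=` O -> V !=set0 -> forall P, pibase V P -> K0 #<= P.
  by move=> oV VO V0 P bP; apply: contrapT => nK; apply: n; exists V, P.
have [V0 [V1 [oV0 oV1 V0O V1O [nV0 nV1 dis]]]] := crowded_split oO O0 crowded.
have [lt ltw] := exists_wo (set X); have [wf tr tot] := ltw.
have [K1 [K1K K01 K1i]] := card_initial K0 ltw.
have K10 := subset_card_le K1K.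
have [a aP] := greedy_free ltw K01 K1i K10 oV0 (nP _ oV0 V0O nV0).
have [e eP] := greedy_free ltw K01 K1i K10 oV1 (nP _ oV1 V1O nV1).
have d0 A : A `<=` V1 -> V0 `&` closure A = set0.
  move=> AV; apply: open_disj_closure => //; apply/seteqP; split=> // x [V0x /AV V1x].
  by rewrite -dis.
have d1 A : A `<=` V0 -> V1 `&` closure A = set0.
  move=> AV; apply: open_disj_closure => //; apply/seteqP; split=> // x [V0x /AV V1x].
  by rewrite -dis.
apply: K0ncode; apply: codes_le K01.
exists (fun y => a y `|` (V1 `\` closure (e y))); split.
  move=> y K1y; have [ra aV _] := aP y K1y; split.
    by apply: openU; [exact: ro_open|exact: open_setD_closure].
  by move=> x [/aV/V0O|[/V1O]].
move=> y z K1y K1z RR; have [ray aVy ay] := aP y K1y; have [raz aVz az] := aP z K1z.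
have [rey eVy ey] := eP y K1y; have [rez eVz ez] := eP z K1z.
rewrite closureU in RR.
have s1 A : V1 `\` A `<=` V1 by move=> x [].
case: (tot y z) => // yz; exfalso.
  apply: (az y K1y yz); apply: ro_sub => //; first exact: ro_open.
  move=> x ax; have [//|Cx] := RR x (or_introl ax).
  suff : set0 x by []; rewrite -(d0 _ (s1 (closure (e z)))); split=> //; exact: aVy.
apply: (ey z K1z yz); apply: ro_sub => //; first exact: ro_open.
move=> x ezx; apply: contrapT => nx.
have [|Cx|Cx] := RR x; first by right; split=> //; exact: eVz.
  by suff : set0 x by []; rewrite -(d1 _ aVz); split=> //; exact: eVz.
have [y' [[_ nn] ey']] := Cx (e z) (open_nbhs_nbhs (conj (ro_open rez) ezx)).
exact/nn/subset_closure.
Qed.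

Lemma codes_bool V : open V -> V `<=` O -> V !=set0 -> codes V [set: bool].
Proof.
move=> oV VO V0; have [|D0 [D1 [op0 op1 DV0 DV1 [[x0 n0] [x1 n1] dis]]]] := crowded_split oV V0.
  by move=> x /VO; exact: crowded.
exists (fun b => if b then D0 else D1); split; first by case.
have nc (A B : set X) x : open A -> A x -> A `&` B = set0 -> ~ (A `<=` closure B).
  move=> oA Ax AB AcB; suff : set0 x by [].
  by rewrite -(open_disj_closure oA AB); split=> //; exact: AcB.
move=> [] [] // _ _ H; exfalso; first exact: (nc _ _ _ op0 n0 dis H).
by apply: (nc _ _ _ op1 n1 _ H); rewrite setIC.
Qed.

(** [C u] is a maximal disjoint family of members of [P] inside [u]. Its union is dense in [u], and
    regular openness recovers [u] from it. *)
Lemma trace_ro_generated V P : open V -> pibase V P ->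
  exists C : set X -> set (set X), forall u, trace_ro V u ->
   [/\ C u `<=` P, (forall D D', C u D -> C u D' -> D `&` D' !=set0 -> D = D') &
     forall u', trace_ro V u' -> C u = C u' -> u = u'].
Proof.
move=> oV [PD Pex].
have ex u : exists C : set (set X), trace_ro V u -> [/\ C `<=` P,
    (forall D D', C D -> C D' -> D `&` D' !=set0 -> D = D'),
    (forall D, C D -> D `<=` u) & u `<=` closure (\bigcup_(D in C) D)].
  have [[V' rV' uE]|nu] := pselect (trace_ro V u); last by exists set0.
  have [C [CP Cdis Cmax]] := ex_maximal_disjoint_subcollection (fun D : set X => D) [set D | P D /\ D `<=` u].
  exists C => _; split.
  - by move=> D /CP[].
  - move=> D D' CD CD' DD; exact: Cdis.
  - by move=> D /CP[].
  - move=> x ux; apply: contrapT => nx.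
    have ou : open u by rewrite uE; apply: openI => //; exact: ro_open.
    have [||D PDD Du] := Pex (u `\` closure (\bigcup_(D in C) D)) (open_setD_closure _ ou).
    + by rewrite uE => y [[]].
    + by exists x.
    have [oD DV [d Dd]] := PD D PDD.
    apply: (Cmax (C `|` [set D])).
    + split; first by move=> E CE; left.
      move=> H; have CD : C D by apply: H; right.
      by have [_] := Du d Dd; apply; apply: subset_closure; exists D.
    + move=> E [/CP//|->]; split=> // y /Du[]//.
    + have Ddis E : C E -> E `&` D = set0.
        move=> CE; apply/seteqP; split=> // y [Ey /Du[_]]; apply; apply: subset_closure; by exists E.
      move=> E E' [CE|->] [CE'|->] // [y [Ey E'y]].
      * by apply: Cdis => //; exists y.
      * by have : (E `&` D) y by []; rewrite Ddis.
      * by have : (E' `&` D) y by []; rewrite Ddis.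
have [C CP] := choice ex.
have sub u u' : trace_ro V u -> trace_ro V u' -> C u = C u' -> u `<=` u'.
  move=> tu tu' e; have [_ _ _ uC] := CP u tu; have [_ _ Cu' _] := CP u' tu'.
  case: (tu) => V1 rV1 uE; case: (tu') => V2 rV2 uE'.
  have ou : open u by rewrite uE; apply: openI => //; exact: ro_open.
  have uV2 : u `<=` V2.
    apply: ro_sub => //; apply: subset_trans uC _; rewrite e; apply: closureS.
    by move=> x [D /Cu' Du Dx]; have := Du x Dx; rewrite uE' => -[].
  move=> x ux; rewrite uE'; split; first exact: uV2.
  by move: ux; rewrite uE => -[].
exists C => u tu; have [CPu Cdis _ _] := CP u tu; split=> // u' tu' e.
by apply/seteqP; split; apply: sub.
Qed.

(* A trace [u] is given by a maximal disjoint family [C u] of members of a small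
   pi-base [P]. If [C u] is equipotent to a fixed [C u0], it is the range of a
   function from [C u0] to [P], and each member of [C u0] codes one value. *)
Lemma self_coding_sub : exists V, [/\ open V, V `<=` O, V !=set0 & self_coding V].
Proof.
have [V [P [oV VO V0 bP nKP]]] := small_pibase; exists V; split=> // V' oV' V'V V'0.
suff : codes V (trace_ro V).
  by move=> /(codes_small VO) h; apply: K0min h => //; exact: subset_trans VO.
have [C CP] := trace_ro_generated oV bP.
have [PD Pex] := bP.
have [lt ltw] := exists_wo (set X).
have [p0 Pp0 _] := Pex V oV (@subset_refl _ V) V0.
(* [t] records the size of [C u]: that of [P], or that of the segment of [P] below [t.2]. *)
pose Ty (t : bool * set X) (D : set (set X)) :=
  if t.1 then D #= P else D #= [set y | P y /\ lt y t.2].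
have ext u : exists t, trace_ro V u -> P t.2 /\ Ty t (C u).
  have [tu|nu] := pselect (trace_ro V u); last by exists (true, set0).
  have [CPu _ _] := CP u tu.
  have [PC|[x [Px Cx]]] := card_segP P (C u) ltw; last by exists (false, x).
  by exists (true, p0) => _; split=> //; rewrite /Ty /= card_eq_le PC (subset_card_le CPu).
have [tau tauP] := choice ext.
(* One half of [V] codes the type [tau u], the other half the traces of a given type. *)
have [|V0' [V1' [oV0' oV1' V0V V1V [nV0 nV1 dis]]]] := crowded_split oV V0.
  by move=> x /VO; exact: crowded.
have V0O := subset_trans V0V VO; have V1O := subset_trans V1V VO.
pose T := [set t : bool * set X | P t.2].
have T0 : codes V0' T.
  suff /(codes_small VO) h : codes V T by exact: K0min h.
  have := @code_sigma bool (set X) [set: bool] (fun=> P) V V0' V1' oV0' oV1' V0V V1V dis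
     (codes_bool oV0' V0O nV0) (fun _ _ => K0min oV1' V1O nV1 nKP).
  by move=> h; apply: codes_le h _; apply: subset_card_le => t Pt.
pose L t := [set u | trace_ro V u /\ tau u = t].
have HL t : T t -> codes V1' (L t).
  move=> Tt; suff /(codes_small VO) h : codes V (L t) by exact: K0min h.
  have [[u0 [tu0 eu0]]|n] := pselect (L t !=set0); last first.
    by exists (fun=> set0); split=> [u Lu|u u' Lu]; exfalso; apply: n; exists u.
  have exf u : exists f : set X -> set X, L t u -> f @` C u0 = C u.
    have [[tu eu]|nL] := pselect (L t u); last by exists id.
    have e : C u0 #= C u.
      have [_ Tu] := tauP u tu; have [_ Tu0] := tauP u0 tu0.
      move: Tu Tu0; rewrite eu eu0 /Ty; case: t.1 => h h0;
        exact: card_eq_trans h0 (card_esym h).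
    have /card_set_bijP[f [fC _ fS]] := e; exists f => _.
    apply/seteqP; split; last exact: fS.
    by move=> _ [D CD <-]; exact: fC.
  have [f fP] := choice exf.
  have [CPu0 Cdis0 _] := CP u0 tu0.
  have [||||R [cR _ _]] := @code_product (set X) (set X) (set X) (C u0) (fun D => D) (fun=> P) (L t) f V.
  - move=> D /CPu0 /PD[oD DV D0]; split=> //.
    by apply: K0min nKP => //; exact: subset_trans VO.
  - by move=> D D'; exact: Cdis0.
  - move=> u D Lu CD; have [tu _] := Lu; have [CPu _ _] := CP u tu; apply: CPu.
    by rewrite -(fP u Lu); exists D.
  - move=> u u' Lu Lu' e; have [tu _] := Lu; have [tu' _] := Lu'.
    have [_ _ inj] := CP u tu; apply: inj => //; rewrite -(fP u Lu) -(fP u' Lu').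
    by apply: eq_imagel => D /e.
  - by exists R.
have := code_sigma oV0' oV1' V0V V1V dis T0 HL.
move=> h; apply: codes_le h _.
apply: (card_le_fun (f := fun u => (tau u, u))) => [u tu|u u' _ _ [] //].
by split=> //=; have [] := tauP u tu.
Qed.
End Homogeneous.

(** Without isolated points in [W], take the least [K0] not coded by some nonempty open subset of
    [W]; that subset satisfies the hypotheses of the section above. If there is no such [K0], then
    [W] itself is self-coding. *)
Lemma cell_exists W : open W -> W !=set0 -> exists2 O, cell O & O `<=` W.
Proof.
move=> oW W0.
have [[x [Wx ox]]|nW] := pselect (exists x, W x /\ open [set x]).
  by exists [set x]; [split=> //; [exists x|left; exists x]|move=> y ->].
have crowded x : W x -> ~ open [set x] by move=> Wx ox; apply: nW; exists x.
pose Q := [set K : set (set X) | exists V, [/\ open V, V `<=` W, V !=set0 & ~ codes V K]].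
have [Q0|nQ] := pselect (Q !=set0); last first.
  exists W => //; split=> //; right=> V oV VW V0; apply: contrapT => nc.
  by apply: nQ; exists (trace_ro W), V.
have [K0 [V0 [oV0 V0W nV0 nc]] Kmin] := card_min Q0.
have Hmin LT (L : set LT) V : open V -> V `<=` V0 -> V !=set0 -> ~ (K0 #<= L) -> codes V L.
  move=> oV VV0 Vn nKL; apply: contrapT => ncL; apply: nKL.
  have [//|LK] := card_le_total K0 L.
  (* [Kmin] only concerns sets of subsets of [X], so [L] is replaced by an equipotent one. *)
  have [f fK fi] := card_le_ex set0 LK.
  have /card_eqPle[fL Lf] := inj_card_eq fi.
  apply: card_le_trans (Kmin (f @` L) _) fL.
  exists V; split=> //; first exact: subset_trans V0W.
  by move=> cf; apply: ncL; exact: codes_le cf Lf.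
have [V [oV VV0 Vn sV]] := self_coding_sub oV0 nV0 (fun x Vx => crowded x (V0W x Vx)) nc Hmin.
exists V; last exact: subset_trans V0W.
by split=> //; right.
Qed.
End Cells.

(** * Supports *)

Section Supports.
Variable X : topologicalType.
Hypotheses (T1 : accessible_space X) (Treg : regular_space X).
Implicit Types (U V W : set X) (p : X).

Lemma exists_cells : exists C : set (set X),
  [/\ forall O, C O -> cell O, forall O O', C O -> C O' -> O `&` O' !=set0 -> O = O' &
   forall W, open W -> W !=set0 -> exists2 O, C O & O `&` W !=set0].
Proof.
have [C [CP Cdis Cmax]] := ex_maximal_disjoint_subcollection (fun D : set X => D) (@cell X).
exists C; split; [exact: CP|by move=> O O' CO CO'; exact: Cdis|move=> W oW W0].
apply: contrapT => n; have [ O cO OW] := cell_exists T1 Treg oW W0.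
have [_ [x Ox] _] := cO.
have dis O' : C O' -> O' `&` O = set0.
  move=> CO'; apply/seteqP; split=> // y [ O'y Oy]; apply: n.
  by exists O' => //; exists y; split=> //; exact: OW.
apply: (Cmax (C `|` [set O])).
- split; first by move=> E CE; left.
  move=> H; have CO : C O by apply: H; right.
  by have : (O `&` O) x by []; rewrite dis.
- by move=> E [/CP//|->].
- move=> E E' [CE|->] [CE'|->] // [y [Ey E'y]].
  + by apply: Cdis => //; exists y.
  + by have : (E `&` O) y by []; rewrite dis.
  + by have : (E' `&` O) y by []; rewrite dis.
Qed.

Variable C : set (set X).
Hypotheses (Ccell : forall O, C O -> cell O)
  (Cdis : forall O O', C O -> C O' -> O `&` O' !=set0 -> O = O')
  (Cdense : forall W, open W -> W !=set0 -> exists2 O, C O & O `&` W !=set0).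

Definition supp U : set (set X) := [set O | C O /\ O `&` U !=set0].

Lemma supp_sub U V : U `<=` V -> supp U `<=` supp V.
Proof. by move=> UV O [CO [x [Ox Ux]]]; split=> //; exists x; split=> //; exact: UV. Qed.

(** A point of [U] chosen in each cell determines the cell, by disjointness. *)
Lemma card_supp U : supp U #<= U.
Proof.
have [[x0 _]|n] := pselect (U !=set0); last first.
  rewrite (_ : supp U = set0) ?card_ge0 //; apply/seteqP; split=> // O [_ [x [_ Ux]]].
  by apply: n; exists x.
have ex O : exists x, supp U O -> O x /\ U x.
  by have [[_ [x [Ox Ux]]]|n] := pselect (supp U O); [exists x|exists x0].
have [f fP] := choice ex.
apply: (card_le_fun (f := f)) => [ O sO|O O' /set_mem sO /set_mem sO' e].
  by have [] := fP O sO.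
have [Ox _] := fP O sO; have [Ox' _] := fP O' sO'.
by apply: Cdis; [case: sO|case: sO'|exists (f O); split=> //; rewrite e].
Qed.

Lemma ro_supp_sub U V : ro U -> ro V -> (forall O, supp U O -> U `&` O `<=` V) -> U `<=` V.
Proof.
move=> rU rV H; have oU := ro_open rU; apply: ro_sub => // x Ux N Nx.
have [||O CO [y [Oy [Uy Ny]]]] := @Cdense (U `&` interior N).
- by apply: openI => //; exact: open_interior.
- by exists x.
- exists y; split; last exact: interior_subset.
  by apply: (H O) => //; split=> //; exists y.
Qed.

Definition with_supp (J : set (set X)) : set (set X) := [set U | ro U /\ supp U = J].

Definition supp_preserving E (R : set X) :=
  forall U, open U -> E `<=` U -> supp (U `\` closure R) = supp U.

(** At such points labels can be stored without leaving the family of sets with a given support. *)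
Definition rich LT (L : set LT) p := forall E, open E -> E p ->
  exists R, code L E R /\ forall l, L l -> supp_preserving E (R l).

Lemma rich_le LT LT' (L : set LT) (L' : set LT') p : L' #<= L -> rich L p -> rich L' p.
Proof.
move=> LL HL E oE Ep.
have [[l' Ll']|n] := pselect (L' !=set0); last first.
  by exists (fun=> set0); split=> [|l Ll]; [split=> [l Ll|l m Ll]|]; exfalso; apply: n; exists l.
have [l0 _] := card_le_neq0 LL (ex_intro _ l' Ll').
have [f fL fi] := card_le_ex l0 LL.
have [R [[RV Ra] Rs]] := HL E oE Ep.
exists (R \o f); split; last by move=> l Ll; apply: Rs; exact: fL.
split=> [l Ll|l m Ll Lm /Ra e]; first by apply: RV; exact: fL.
by apply: fi; [exact: mem_set|exact: mem_set|apply: e; exact: fL].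
Qed.

Lemma ro_set0 : ro (@set0 X).
Proof. by rewrite /ro closure0 interior0. Qed.

Lemma ro_setT : ro [set: X].
Proof. by rewrite /ro closureT interiorT. Qed.

(** A regular open set is determined by its traces on the cells it meets. On singleton cells the
    trace is forced; each other cell codes its own traces. *)
Lemma code_with_supp E : open E -> exists R, code (with_supp (supp E)) E R /\
  forall U, with_supp (supp E) U -> supp_preserving E (R U).
Proof.
move=> oE.
pose J := [set O | supp E O /\ ~ exists x, O = [set x]].
have [||||R [cR Rsub Rnd]] := @code_product X (set X) (set X) (set X) J (fun O => O `&` E)
  (@trace_ro X) (with_supp (supp E)) (fun U O => U `&` O) E.
- move=> O [[CO OE] ns]; have [oO _ [//|sO]] := Ccell CO.
  have oOE : open (O `&` E) by exact: openI.
  by split=> //; apply: sO.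
- move=> O O' [[CO _] _] [[CO' _] _] [x [[Ox _] [Ox' _]]].
  by apply: Cdis => //; exists x.
- by move=> U O [rU _] _; exists U.
- have sub U U' : with_supp (supp E) U -> with_supp (supp E) U' ->
      (forall O, J O -> U `&` O = U' `&` O) -> U `<=` U'.
    move=> [rU sU] [rU' sU'] H; apply: ro_supp_sub => // O sO x [Ux Ox].
    have [[y Oy]|ns] := pselect (exists y, O = [set y]); last first.
      have : (U `&` O) x by [].
      by rewrite H; [case|split=> //; rewrite -sU].
    have : supp U' O by rewrite sU' -sU.
    by move=> [_ [z [Oz U'z]]]; move: Ox Oz U'z; rewrite Oy => -> ->.
  move=> U U' wU wU' H; apply/seteqP; split; apply: sub => // O JO.
  by rewrite H.
exists R; split=> // l wl U oU EU; apply/seteqP; split; first by apply: supp_sub => x [].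
move=> O [CO [x [Ox Ux]]]; split=> //; apply: contrapT => n.
have OUR : O `&` U `<=` closure (R l).
  by move=> y [Oy Uy]; apply: contrapT => ny; apply: n; exists y.
have [oO _ _] := Ccell CO.
have [JO|nJO] := pselect (J O).
  apply: (Rnd l O wl JO); last by move=> y [Oy Ey]; apply: OUR; split=> //; exact: EU.
  (* The empty trace or the full trace [O] differs from that of [l], so the code does not exhaust
     this cell. *)
  have [e|ne] := pselect (l `&` O = set0); last first.
    by exists set0; [exists set0; [exact: ro_set0|rewrite set0I]|move=> e; apply: ne].
  exists O; first by exists [set: X]; [exact: ro_setT|rewrite setTI].
  by rewrite e => e'; rewrite e' in Ox.
have OR : O `&` R l = set0.
  apply/seteqP; split=> // y [Oy /(Rsub l wl)[ O' JO' [ O'y _]]]; apply: nJO.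
  have [[CO' _] _] := JO'.
  suff -> : O = O' by [].
  by apply: Cdis => //; exists y.
suff : set0 x by [].
by rewrite -(open_disj_closure oO OR); split=> //; apply: OUR.
Qed.

(** Choose [V] with the fewest regular open sets of its support. Smaller neighbourhoods then have at
    least as many, and code them by [code_with_supp]. *)
Lemma exists_rich p V0 : open V0 -> V0 p -> exists V,
  [/\ ro V, V p, V `<=` V0, rich (with_supp (supp V)) p &
   forall E, ro E -> E p -> E `<=` V0 -> with_supp (supp V) #<= with_supp (supp E)].
Proof.
move=> oV0 V0p.
pose Q := [set F | exists V, [/\ ro V, V p, V `<=` V0 & F = with_supp (supp V)]].
have [|F [V [rV Vp VV0 FE]] Fmin] := @card_min _ Q.
  have [V [rV Vp VV0]] := regular_sub Treg oV0 V0p.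
  by exists (with_supp (supp V)), V.
have Vmin E : ro E -> E p -> E `<=` V0 -> with_supp (supp V) #<= with_supp (supp E).
  by move=> rE Ep EV0; rewrite -FE; apply: Fmin; exists E.
exists V; split=> // E oE Ep.
have [E' [rE' E'p E'E]] := regular_sub Treg (openI oE oV0) (conj Ep V0p).
have le := Vmin E' rE' E'p (fun x E'x => (E'E x E'x).2).
have [R [[RV Ra] Rs]] := code_with_supp (ro_open rE').
have [f fL fi] := card_le_ex set0 le.
have EE : E' `<=` E by move=> x /E'E[].
exists (R \o f); split; last first.
  by move=> l Ll U oU EU; apply: (Rs (f l)) => //; [exact: fL|exact: subset_trans EU].
split=> [l Ll|l m Ll Lm /Ra e].
  by have [oR RE] := RV (f l) (fL l Ll); split=> //; exact: subset_trans EE.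
by apply: fi; [exact: mem_set|exact: mem_set|apply: e; exact: fL].
Qed.

(** Every [U] serves as its own label, with the one-member family [[set U]]. Points isolated among
    the rich ones are left to [isolated_base]. *)
Lemma fixed_supp_base J : exists B : set (set X),
  [/\ B `<=` with_supp J, noetherian_family B &
  forall p U, rich (with_supp J) p -> with_supp J U -> U p ->
   limit_pt [set q | rich (with_supp J) q] p \/
   U `&` [set q | rich (with_supp J) q] `<=` [set p] ->
   exists U', [/\ B U', U' p & U' `<=` U]].
Proof.
pose A := [set q | rich (with_supp J) q].
have [|||B1 [B1P nB1 HB1]] := @coding X T1 Treg (set X) (with_supp J) A (with_supp J) (fun U => [set U]).
- by move=> U [].
- move=> a V Aa oV Va; have [R [cR Rs]] := Aa V oV Va; exists R => // l U Ll [rU sU] VU.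
  split; last by rewrite (Rs l Ll) //; exact: ro_open.
  by apply: ro_setD_closure => //; have [RV _] := cR; have [] := RV l Ll.
- by move=> U wU; split; [move=> _ ->|exact: noeth_set1].
have [B2 [B2P nB2 HB2]] := isolated_base A (with_supp J).
exists (B1 `|` B2); split; first by move=> U [/B1P|/B2P].
  exact: noethU.
move=> p U Ap wU Up [acc|UA].
  have [U' [BU' U'p U'U]] := HB1 U U p wU erefl Up acc.
  by exists U'; split=> //; left.
have [U' [BU' U'p U'U]] := HB2 p U Ap wU Up UA.
by exists U'; split=> //; right.
Qed.

Lemma exists_supp_bases : exists BB : set (set X) -> set (set X),
  (forall J, BB J `<=` with_supp J /\ noetherian_family (BB J)) /\
  forall p V0, open V0 -> V0 p -> exists J U, [/\ BB J U, U p & U `<=` V0].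
Proof.
have [BB BP] := choice fixed_supp_base.
exists BB; split; first by move=> J; have [] := BP J.
move=> p V0 oV0 V0p.
have [V [rV Vp VV0 richV Vmin]] := exists_rich oV0 V0p.
pose A := [set q | rich (with_supp (supp V)) q].
have [acc|nacc] := pselect (limit_pt A p).
  have [_ _ H] := BP (supp V).
  have [|U' [BU' U'p U'V]] := H p V richV (conj rV erefl) Vp; first by left.
  by exists (supp V), U'; split=> //; exact: subset_trans VV0.
have [N [oN Np NA]] := isolatedP T1 (richV : A p) nacc.
have [V1 [rV1 V1p V1N rich1 _]] := exists_rich (openI oN oV0) (conj Np V0p).
(* Passing to [V1] cannot decrease the set of labels, so fewer points are rich. *)
have le : with_supp (supp V) #<= with_supp (supp V1).
  by apply: Vmin => // x /V1N[].
have [_ _ H] := BP (supp V1).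
have [|U' [BU' U'p U'V]] := H p V1 rich1 (conj rV1 erefl) V1p.
  right=> x [/V1N[Nx _] rx]; apply: NA; split=> //; exact: rich_le le rx.
by exists (supp V1), U'; split=> //; apply: subset_trans U'V _ => x /V1N[].
Qed.

(** The label of [U] is the colour of its support. Supports increase along a chain, so with one
    colour they are constant, and the bases for a fixed support are Noetherian. *)
Lemma noeth_outer_base_coloured K (S : set X) : infinite_set [set: K] ->
  (forall p V, S p -> open V -> V p -> codes V [set: set K]) ->
  (forall p, S p -> exists G, [/\ open G, G p & supp G #<= [set: K]]) -> noeth_outer_base S.
Proof.
move=> infK Scode Ssupp.
have [col colP] := @antichain_colouring (set X) K infK.
have [BB [BBP BBex]] := exists_supp_bases.
pose B g := [set U | [/\ BB (supp U) U, supp U #<= [set: K] & col (supp U) = g]].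
have [|||B' [B'r nB' HB']] := @coding X T1 Treg (set K) [set: set K] S (@ro X) B.
- by [].
- move=> a V Sa oV Va; have [R cR] := Scode a V Sa oV Va; exists R => // l U Ll rU VU.
  by apply: ro_setD_closure => //; have [RV _] := cR; have [] := RV l Ll.
- move=> g _; split; first by move=> U [BU _ _]; have [BW _] := BBP (supp U); have [] := BW U BU.
  move=> [f [fB fS]]; have [_ nBB] := BBP (supp (f 0%N)); apply: nBB; exists f; split=> // n.
  have [BU UK cU] := fB n; have [_ _ c0] := fB 0%N.
  suff -> : supp (f 0%N) = supp (f n) by [].
  apply: colP => //; last by rewrite c0 cU.
  by apply: supp_sub; apply: strict_chain_sub fS _ _ (leq0n n).
apply: (@noeth_outer_base_sub _ ([set p | S p /\ limit_pt S p] `|` [set p | S p /\ ~ limit_pt S p])).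
  by move=> p Sp; have [?|?] := pselect (limit_pt S p); [left|right].
apply: noeth_outer_baseU; last exact: noeth_outer_base_isolated.
exists B'; split=> // p V [Sp acc] oV Vp.
have [G [oG Gp GK]] := Ssupp p Sp.
have [J [U [BU Up UVG]]] := BBex p (V `&` G) (openI oV oG) (conj Vp Gp).
have [BW _] := BBP J; have [_ sU] := BW U BU.
have [|U' [BU' U'p U'U]] := HB' (col (supp U)) U p I _ Up acc.
  split=> //; first by rewrite sU.
  by apply: card_le_trans GK; apply/subset_card_le/supp_sub => x /UVG[].
by exists U'; split=> // x /U'U/UVG[].
Qed.

Definition supp_le T (K : set T) : set X :=
  [set p | exists G, [/\ open G, G p & supp G #<= K]].

Lemma supp_le_card T T' (K : set T) (K' : set T') : K #<= K' -> supp_le K `<=` supp_le K'.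
Proof. by move=> KK p [G [oG Gp GK]]; exists G; split=> //; exact: card_le_trans KK. Qed.

(** Since [K] absorbs its square, [K] cells meeting [V] can be grouped into [K] disjoint pairs; [h]
    embeds the booleans into [K]. *)
Lemma codes_supp T (K : set T) p V : infinite_set K -> open V -> V p -> K #<= supp V ->
  codes V [set: set K].
Proof.
move=> infK oV Vp KV.
have infK' : infinite_set [set: K].
  by move=> f; apply: infK; apply: card_le_finite f; have := card_setT_sym K; rewrite card_eq_le => /andP[].
have KV' : [set: K] #<= supp V.
  by apply: card_le_trans KV; have := card_setT K; rewrite card_eq_le => /andP[].
have [f fS fi] := card_le_ex set0 KV'.
have [pr pri] := exists_pairing infK'.
have [h _ hi] : exists2 h : nat -> K, set_fun [set: nat] [set: K] h & set_inj [set: nat] h.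
  by have [k0 _] := infinite_setN0 infK'; apply: (card_le_ex k0); exact/infiniteP.
have hb (b c : bool) : h b = h c -> b = c.
  by move=> /(hi _ _ (mem_setT _) (mem_setT _)); case: b c => -[].
pose D (i : K * bool) := f (pr (i.1, h i.2)) `&` V.
apply: (@codes_powerset _ _ _ D).
  move=> i; have [CO OV] := fS (pr (i.1, h i.2)) I; have [oO _ _] := Ccell CO.
  by split=> //; [exact: openI|move=> x []].
move=> [k b] [k' b'] [x [[/= fx _] [fx' _]]].
have [CO _] := fS (pr (k, h b)) I; have [CO' _] := fS (pr (k', h b')) I.
have e : f (pr (k, h b)) = f (pr (k', h b')) by apply: Cdis => //; exists x.
by have /pri[-> /hb->] := fi _ _ (mem_setT _) (mem_setT _) e.
Qed.

Lemma codes_supp_le T (K : set T) p V : infinite_set K -> ~ supp_le K p -> open V -> V p ->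
  codes V [set: set K].
Proof.
move=> infK nK oV Vp; apply: (codes_supp infK oV Vp).
by have [//|VK] := card_le_total K (supp V); exfalso; apply: nK; exists V.
Qed.

(** Start of the induction: neighbourhoods of nonisolated points already code the subsets of [nat],
    which suffice to colour countable supports. *)
Lemma noeth_outer_base_supp_countable T (K : set T) : countable K -> noeth_outer_base (supp_le K).
Proof.
move=> cK; apply: (@noeth_outer_base_sub _ ([set p | open [set p]] `|` (supp_le K `&` [set p | ~ open [set p]]))).
  by move=> p Kp; have [?|?] := pselect (open [set p]); [left|right].
apply: noeth_outer_baseU; first exact: noeth_outer_base_isolated_points.
apply: (@noeth_outer_base_coloured nat); first exact: infinite_nat.
- by move=> p V [_ np]; exact: not_isolated_codes.
- by move=> p [[G [oG Gp GK]] _]; exists G; split=> //; exact: card_le_trans cK.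
Qed.

Lemma codes_label T (K : set T) V : codes V [set: set K] -> codes V K.
Proof.
move=> h; apply: codes_le h _; apply: card_le_trans (card_le_powerset K).
by have := card_setT_sym K; rewrite card_eq_le => /andP[].
Qed.

Lemma card_le_subsets T (L : set T) K (k0 : K) :
  L #<= [set: K] -> [set A : set T | A `<=` L] #<= [set: set K].
Proof.
move=> /(card_le_ex k0)[f _ fi].
apply: (card_le_fun (f := fun A => f @` A)) => [//|A A' /set_mem AL /set_mem A'L e].
have sub (B B' : set T) : B `<=` L -> B' `<=` L -> f @` B = f @` B' -> B `<=` B'.
  move=> BL BL' E x Bx; have : (f @` B') (f x) by rewrite -E; exists x.
  by move=> [y B'y e2]; rewrite -(fi y x (mem_set (BL' _ B'y)) (mem_set (BL _ Bx)) e2).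
by apply/seteqP; split; apply: sub.
Qed.

(** * Induction on the size of the supports *)

Section Induction.
Variables (M : Type) (K : set M).
Hypotheses (Kunc : uncountable_card K) (Kacc : ~ strongly_inaccessible K).
Hypothesis IH : forall K' : set M, card_lt K' K -> noeth_outer_base (supp_le K').

Let infK : infinite_set K.
Proof. by move=> f; apply: Kunc; exact: finite_set_countable. Qed.

(** [IH] speaks of subsets of [M]; an injection into [K] replaces [K'] by one of them. *)
Lemma noeth_outer_base_supp_lt T (K' : set T) : card_lt K' K -> noeth_outer_base (supp_le K').
Proof.
move=> [KK nK].
have [m0 _] : K !=set0 by exact: infinite_setN0.
have [f fK fi] := card_le_ex m0 KK.
have /card_eqPle[fL Lf] := inj_card_eq fi.
apply: (noeth_outer_base_sub (supp_le_card Lf)); apply: IH; split.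
  exact: card_le_trans KK.
by move=> h; apply: nK; exact: card_le_trans fL.
Qed.

Definition supp_lt : set X := [set p | exists E, [/\ open E, E p & card_lt (supp E) K]].

(** Sizes below [K] are sizes of initial segments and are labelled by points of [K]. Nonisolated
    points outside [supp_le L] have room for [2^L >= K] labels; those of [supp_le L] fall under the
    induction hypothesis. *)
Lemma noeth_outer_base_not_strong_limit I (L : set I) :
  card_lt L K -> ~ card_lt [set A : set I | A `<=` L] K -> noeth_outer_base supp_lt.
Proof.
move=> LK /card_ltP/contrapT KP.
apply: (@noeth_outer_base_sub _ ((supp_lt `&` [set p | ~ open [set p]] `&` ~` supp_le L) `|`
    ([set p | open [set p]] `|` supp_le L))).
  move=> p Dp; have [?|?] := pselect (open [set p]); first by right; left.
  by have [?|?] := pselect (supp_le L p); [right; right|left].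
apply: noeth_outer_baseU; last by apply: noeth_outer_baseU; [exact: noeth_outer_base_isolated_points|exact: noeth_outer_base_supp_lt].
have [lt ltw] := exists_wo M.
pose seg x := [set y | K y /\ lt y x].
apply: (@noeth_outer_base_coded _ T1 Treg _ M K (fun x => [set p | card_lt (seg x) K /\ supp_le (seg x) p])).
- move=> p V [[_ np] npL] oV Vp.
  have [finL|infL] := pselect (finite_set L).
    apply: codes_le (not_isolated_codes T1 Treg np oV Vp) _; apply: card_le_trans KP _.
    exact: (card_le_subsets 0%N (finite_set_countable finL)).
  apply: codes_le (codes_supp_le infL npL oV Vp) _; apply: card_le_trans KP _.
  have [l0 Ll0] := infinite_setN0 infL.
  apply: (card_le_subsets (SigSub (mem_set Ll0) : L)).
  by have := card_setT_sym L; rewrite card_eq_le => /andP[].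
(* If the segment is not smaller than [K], the set of points with label [x] is empty. *)
- move=> x Kx; have [sK|n] := pselect (card_lt (seg x) K).
    by apply: noeth_outer_base_sub (noeth_outer_base_supp_lt sK) => p [].
  by apply: noeth_outer_base_sub (noeth_outer_base_supp_countable (countable0 M)) => p [].
- move=> p [[[E [oE Ep EK]] _] _]; have [EK' nEK] := EK.
  have [//|[x [Kx /card_eqPle[Ex xE]]]] := card_segP K (supp E) ltw.
  exists x => //; split; last by exists E.
  by split; [exact: card_le_trans EK'|move=> h; apply: nEK; exact: card_le_trans xE].
Qed.

(** Here the labels are the members of [J], and [i] stands for the supports of size at most [F i].
    Some [F i] bounds a given smaller support, as otherwise [K] would embed into a product of two
    smaller sets. *)
Lemma noeth_outer_base_singular I (J : set I) T (F : I -> set T) : card_lt J K ->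
  (forall i, J i -> card_lt (F i) K) -> K #<= \bigcup_(i in J) F i -> noeth_outer_base supp_lt.
Proof.
move=> JK FK KF.
apply: (@noeth_outer_base_sub _ ((supp_lt `&` [set p | ~ open [set p]] `&` ~` supp_le J) `|`
    ([set p | open [set p]] `|` supp_le J))).
  move=> p Dp; have [?|?] := pselect (open [set p]); first by right; left.
  by have [?|?] := pselect (supp_le J p); [right; right|left].
apply: noeth_outer_baseU; last by apply: noeth_outer_baseU; [exact: noeth_outer_base_isolated_points|exact: noeth_outer_base_supp_lt].
apply: (@noeth_outer_base_coded _ T1 Treg _ I J (fun i => supp_le (F i))).
- move=> p V [[_ np] npJ] oV Vp.
  have [finJ|infJ] := pselect (finite_set J).
    apply: codes_le (not_isolated_codes T1 Treg np oV Vp) _.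
    exact: card_le_trans (finite_set_countable finJ) (card_le_powerset nat).
  exact/codes_label/(codes_supp_le infJ npJ oV Vp).
- by move=> i Ji; apply: noeth_outer_base_supp_lt; exact: FK.
- move=> p [[[E [oE Ep EK]] _] _].
  suff [i Ji EF] : exists2 i, J i & supp E #<= F i by exists i => //; exists E.
  apply: contrapT => n.
  have FE i : J i -> F i #<= supp E.
    by move=> Ji; have [//|EF] := card_le_total (F i) (supp E); exfalso; apply: n; exists i.
  have KJE : K #<= J `*` supp E.
    apply: (card_le_trans (KF)).
    have exi x : exists i, (\bigcup_(i in J) F i) x -> J i /\ F i x.
      have [[i Ji Fi]|nx] := pselect ((\bigcup_(i in J) F i) x); first by exists i.
      have [k Kk] := infinite_setN0 infK.
      have [y [i Ji Fi]] := card_le_neq0 KF (ex_intro _ k Kk).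
      by exists i.
    have [c cP] := choice exi.
    have exg i : exists g : T -> set X, J i -> set_fun (F i) (supp E) g /\ set_inj (F i) g.
      have [Ji|nJ] := pselect (J i); last by exists (fun=> set0).
      by have [g gF gi] := card_le_ex set0 (FE i Ji); exists g.
    have [g gP] := choice exg.
    apply: (card_le_fun (f := fun x => (c x, g (c x) x))).
      by move=> x /cP[Jc Fc]; split=> //=; have [gF _] := gP _ Jc; exact: gF.
    move=> x y /set_mem/cP[Jx Fx] /set_mem/cP[Jy Fy] [exy].
    rewrite -exy in Fy *; have [_ gi] := gP _ Jx; apply: gi; exact: mem_set.
  have fin2 : finite_set J -> finite_set (supp E) -> False.
    by move=> fJ fE; apply: infK; apply: card_le_finite KJE (finite_setX fJ fE).
  have [JE|EJ] := card_le_total J (supp E).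
    have infE : infinite_set (supp E) by move=> fE; apply: fin2 => //; exact: card_le_finite fE.
    have [_] := EK; apply; apply: card_le_trans KJE _.
    apply: card_le_trans (card_le_sq infE); exact: card_leX.
  have infJ : infinite_set J by move=> fJ; apply: fin2 => //; exact: card_le_finite fJ.
  have [_] := JK; apply; apply: card_le_trans KJE _.
  apply: card_le_trans (card_le_sq infJ); exact: card_leX.
Qed.

(** The two lemmas above settle [supp_lt]. At the remaining points every neighbourhood meets at
    least [K] cells, hence codes the [2^K] colours. *)
Lemma noeth_outer_base_supp_le_step : noeth_outer_base (supp_le K).
Proof.
have Dlt : noeth_outer_base supp_lt.
  apply: contrapT => nD; apply: Kacc; split=> //.
    move=> I J F JK FK KF; apply: nD.
    by apply: (noeth_outer_base_singular JK FK); exact: subset_card_le.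
  by move=> I L LK; apply: contrapT => nP; apply: nD; exact: noeth_outer_base_not_strong_limit nP.
apply: (@noeth_outer_base_sub _ (supp_lt `|` (supp_le K `&` ~` supp_lt))).
  by move=> p Kp; have [?|?] := pselect (supp_lt p); [left|right].
apply: noeth_outer_baseU => //.
have infK' : infinite_set [set: K].
  by move=> f; apply: infK; apply: card_le_finite f; have := card_setT_sym K; rewrite card_eq_le => /andP[].
apply: (@noeth_outer_base_coloured K) => // [p V [_ np] oV Vp|p [[G [oG Gp GK]] _]].
  apply: (codes_supp infK oV Vp); apply: contrapT => nKV; apply: np.
  by exists V; split=> //; exact/card_ltP.
exists G; split=> //; apply: card_le_trans GK _.
by have := card_setT_sym K; rewrite card_eq_le => /andP[].
Qed.
End Induction.

Lemma noeth_outer_base_supp_le M (K : set M) :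
  (forall K : set M, ~ strongly_inaccessible K) -> noeth_outer_base (supp_le K).
Proof.
move=> noacc; elim/card_ind: K => K IH.
have [cK|nK] := pselect (countable K); first exact: noeth_outer_base_supp_countable.
exact: noeth_outer_base_supp_le_step.
Qed.
End Supports.

(** * From outer bases to a base of the space *)

Lemma outer_base_has_noetherian_base (X : topologicalType) : noeth_outer_base [set: X] -> has_noetherian_base X.
Proof.
move=> [B [Br nB HB]]; exists B; split=> //; split=> [A /Br/ro_open//|U oU].
apply/seteqP; split=> [p Up|p [A [_ AU] Ap]]; last exact: AU.
by have [A [BA Ap AU]] := HB p U I oU Up; exists A.
Qed.

Unset Implicit Arguments.

(* The cardinal mu is represented by a type M (mu = |M|); cardinals <= mu are
   represented by subsets of M. *)
Theorem theorem4 (X : topologicalType) (M : Type) :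
  T3_space X ->
  (forall p : X, exists G : set X, [/\ open G, G p & G #<= [set: M]]) ->
  (forall K : set M, ~ strongly_inaccessible K) ->
  has_noetherian_base X.
Proof.
move=> [T1 Treg] locM noacc; apply: outer_base_has_noetherian_base.
have [C [Ccell Cdis Cdense]] := exists_cells T1 Treg.
(* A neighbourhood meets at most as many cells as it has points, so [supp_le [set: M]] is the whole
   space. *)
apply: noeth_outer_base_sub (noeth_outer_base_supp_le T1 Treg Ccell Cdis Cdense [set: M] noacc) => p _.
have [G [oG Gp GM]] := locM p; exists G; split=> //.
by apply: card_le_trans GM; exact: card_supp Cdis _.
Qed.
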